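(* Let $L:[0,T]\times\mathbb{R}^N\times\mathbb{R}^N\to\mathbb{R}\cup\{\pm\infty\}$ satisfy (L1)–(L5), and let $U:[0,T]\times\mathbb{R}^N\to\mathbb{R}\cup\{\pm\infty\}$ be proper and lower semicontinuous and satisfy: for every $(t,x)\in\mathrm{dom}\,U\cap[0,T)\times\mathbb{R}^N$ and every $(n^t,n^x,n^u)\in N_{\mathrm{epi}\,U}(t,x,U(t,x))$ there exist sequences $(t_k,x_k)\to(t,x)$, $\alpha_k\to0$ and $v_k\in\mathrm{dom}\,L(t_k,x_k,\cdot)$ such that $n^t+\langle v_k,n^x\rangle-n^uL(t_k,x_k,v_k)\leq\alpha_k$ for all $k\in\mathbb{N}$. Then for every $(t_0,x_0)\in\mathrm{dom}\,U\cap[0,T)\times\mathbb{R}^N$ there exists an absolutely continuous $(x,u):[t_0,T]\to\mathbb{R}^N\times\mathbb{R}$ with $(x,u)(t_0)=(x_0,U(t_0,x_0))$, $(\dot x(t),\dot u(t))\in Q(t,x(t))$ for a.e. $t\in[t_0,T]$, and $u(t)\geq U(t,x(t))$ for all $t\in[t_0,T]$.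
   Context: $\mathbb{B}_R$ is the closed ball of radius $R$ at $0$. For a function $\varphi$, $\mathrm{dom}\,\varphi=\{z:\varphi(z)\neq\pm\infty\}$, $\mathrm{epi}\,\varphi=\{(z,r):\varphi(z)\leq r\}$; $\varphi$ is proper if it never equals $-\infty$ and is not identically $+\infty$. $U$ is regarded as $+\infty$ outside $[0,T]\times\mathbb{R}^N$. For $E\subset\mathbb{R}^M$, $w\in E$: tangent cone $T_E(w)=\{\zeta:\liminf_{\tau\to0^+}\mathrm{dist}(w+\tau\zeta,E)/\tau=0\}$, normal cone $N_E(w)=\{\xi:\langle\zeta,\xi\rangle\leq0\ \forall\zeta\in T_E(w)\}$. $Q(t,x):=\{(v,\eta)\in\mathbb{R}^N\times\mathbb{R}: L(t,x,v)\leq-\eta\}$. (L1) $L$ is lower semicontinuous in all variables. (L2) $L(t,x,\cdot)$ is convex and proper for every $t,x$. (L3) for every $(t,x,v)$ and every $(t_n,x_n)\to(t,x)$ there exist $v_n\to v$ with $L(t_n,x_n,v_n)\to L(t,x,v)$. (L4) for every $R\geq0$ there is $C_R\geq0$ with $L(t,x,v)=+\infty$ whenever $t\in[0,T]$, $x\in\mathbb{B}_R$, $|v|>C_R$. (L5) there are an integrable $c:[0,T]\to[0,\infty)$ and a null set $\mathcal{N}$ with $L(t,x,v)=+\infty$ whenever $t\notin\mathcal{N}$ and $|v|>c(t)(1+|x|)$. *)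

(* Defs.v *)
From HB Require Import structures.
From mathcomp Require Import all_boot all_order all_algebra.
From mathcomp Require Import all_classical all_reals all_analysis.
Set Implicit Arguments. Unset Strict Implicit. Unset Printing Implicit Defensive.
Import Order.TTheory GRing.Theory Num.Theory.
Import numFieldNormedType.Exports.
Local Open Scope classical_set_scope.
Local Open Scope ring_scope.

Definition dotv {R : realType} {N : nat} (x y : 'rV[R]_N) : R :=
  \sum_(i < N) x ord0 i * y ord0 i.
Definition enorm {R : realType} {N : nat} (x : 'rV[R]_N) : R :=
  Num.sqrt (dotv x x).

Definition pt (R : realType) (N : nat) := (R * 'rV[R]_N * R)%type.
Definition dotp {R : realType} {N : nat} (p q : pt R N) : R :=
  p.1.1 * q.1.1 + dotv p.1.2 q.1.2 + p.2 * q.2.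
Definition pnorm {R : realType} {N : nat} (p : pt R N) : R := Num.sqrt (dotp p p).
Definition paddscale {R : realType} {N : nat} (w : pt R N) (tau : R) (z : pt R N)
  : pt R N := (w.1.1 + tau * z.1.1, w.1.2 + tau *: z.1.2, w.2 + tau * z.2).
Definition psub {R : realType} {N : nat} (p q : pt R N) : pt R N :=
  (p.1.1 - q.1.1, p.1.2 - q.1.2, p.2 - q.2).

(* Euclidean distance to a set (extended-real valued: +oo for the empty set) *)
Definition pdist {R : realType} {N : nat} (w : pt R N) (E : set (pt R N)) : \bar R :=
  ereal_inf [set (pnorm (psub w e))%:E | e in E].

(* Tangent cone: liminf_{tau -> 0+} dist(w + tau z, E)/tau = 0.  Since the
   quotient is nonnegative, this liminf is 0 iff for all eps, delta > 0 there is
   tau in (0, delta) with dist(w + tau z, E) / tau < eps. *)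
Definition tangent_cone {R : realType} {N : nat} (E : set (pt R N)) (w : pt R N)
  : set (pt R N) :=
  [set z | forall eps : R, 0 < eps -> forall delta : R, 0 < delta ->
     exists tau : R, 0 < tau < delta /\ (pdist (paddscale w tau z) E < (eps * tau)%:E)%E].

Definition normal_cone {R : realType} {N : nat} (E : set (pt R N)) (w : pt R N)
  : set (pt R N) :=
  [set xi | forall z, tangent_cone E w z -> dotp z xi <= 0].

Definition Uext {R : realType} {N : nat} (T : R) (U : R -> 'rV[R]_N -> \bar R)
  (t : R) (x : 'rV[R]_N) : \bar R :=
  if (0 <= t) && (t <= T) then U t x else +oo%E.

Definition epiU {R : realType} {N : nat} (T : R) (U : R -> 'rV[R]_N -> \bar R)
  : set (pt R N) :=
  [set p | (Uext T U p.1.1 p.1.2 <= p.2%:E)%E].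

Definition Qset {R : realType} {N : nat} (L : R -> 'rV[R]_N -> 'rV[R]_N -> \bar R)
  (t : R) (x : 'rV[R]_N) : set ('rV[R]_N * R) :=
  [set ve | (L t x ve.1 <= (- ve.2)%:E)%E].

Definition abs_cont {R : realType} {V : normedModType R} (a b : R) (f : R -> V) : Prop :=
  forall eps : R, 0 < eps -> exists2 delta : R, 0 < delta &
    forall (n : nat) (s t : nat -> R),
      (forall i, (i < n)%N -> a <= s i /\ s i < t i /\ t i <= b) ->
      (forall i j, (i < n)%N -> (j < n)%N -> i <> j -> t i <= s j \/ t j <= s i) ->
      \sum_(i < n) (t i - s i) < delta ->
      \sum_(i < n) `|f (t i) - f (s i)| < eps.

Definition L1 {R : realType} {N : nat} (T : R)
  (L : R -> 'rV[R]_N -> 'rV[R]_N -> \bar R) : Prop :=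
  forall t x v, 0 <= t <= T -> forall a : R, (a%:E < L t x v)%E ->
    \forall p \near ((t, x, v) : R * 'rV[R]_N * 'rV[R]_N),
      0 <= p.1.1 <= T -> (a%:E < L p.1.1 p.1.2 p.2)%E.

Definition L2 {R : realType} {N : nat} (T : R)
  (L : R -> 'rV[R]_N -> 'rV[R]_N -> \bar R) : Prop :=
  forall t x, 0 <= t <= T ->
    [/\ forall (v w : 'rV[R]_N) (lam : R), 0 < lam < 1 ->
          (L t x ((lam *: v + (1 - lam) *: w)%R) <= lam%:E * L t x v + (1 - lam)%:E * L t x w)%E,
        forall v, L t x v <> -oo%E
      & exists v, L t x v <> +oo%E].

Definition L3 {R : realType} {N : nat} (T : R)
  (L : R -> 'rV[R]_N -> 'rV[R]_N -> \bar R) : Prop :=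
  forall t x v, 0 <= t <= T ->
    forall (tn : nat -> R) (xn : nat -> 'rV[R]_N),
      (forall n, 0 <= tn n <= T) -> tn @ \oo --> t -> xn @ \oo --> x ->
      exists vn : nat -> 'rV[R]_N,
        vn @ \oo --> v /\ (fun n => L (tn n) (xn n) (vn n)) @ \oo --> L t x v.

Definition L4 {R : realType} {N : nat} (T : R)
  (L : R -> 'rV[R]_N -> 'rV[R]_N -> \bar R) : Prop :=
  forall Rad : R, 0 <= Rad -> exists2 C : R, 0 <= C &
    forall t x v, 0 <= t <= T -> enorm x <= Rad -> C < enorm v -> L t x v = +oo%E.

Definition L5 {R : realType} {N : nat} (T : R)
  (L : R -> 'rV[R]_N -> 'rV[R]_N -> \bar R) : Prop :=
  exists c : R -> R,
    [/\ forall t, 0 <= t <= T -> 0 <= c t,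
        (@lebesgue_measure R).-integrable `[0, T] (EFin \o c)
      & exists Nn : set R, (@lebesgue_measure R).-negligible Nn /\
          forall t x v, 0 <= t <= T -> ~ Nn t ->
            c t * (1 + enorm x) < enorm v -> L t x v = +oo%E].

Definition U_proper {R : realType} {N : nat} (T : R) (U : R -> 'rV[R]_N -> \bar R) : Prop :=
  (forall t x, Uext T U t x <> -oo%E) /\ (exists t x, Uext T U t x <> +oo%E).

Definition U_lsc {R : realType} {N : nat} (T : R) (U : R -> 'rV[R]_N -> \bar R) : Prop :=
  lower_semicontinuous (fun p : R * 'rV[R]_N => Uext T U p.1 p.2).

(* Main.v *)
(* Let U_eps be the infimal convolution of U with |.|^2/(2 eps). At a minimising point (s, y) the
   vector ((t - s)/eps, (x - y)/eps, -1) is normal to epi U; as its last entry is not 0, the normal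
   condition and the lower semicontinuity of L give a velocity v with L(s, y, v) finite along which
   U_eps decreases at rate L(s, y, v), up to O(h^2/eps). An Euler scheme with steps h = eps^2 hence
   yields approximate trajectories. They are stopped on leaving a large ball, where L4 bounds v and
   L is bounded below, so that x is Lipschitz and m t - u is nondecreasing.

   A pointwise limit (x, u) along an ultrafilter satisfies U(t, x(t)) <= u(t). For an affine
   function v |-> <v, p> - k strictly below L(t, x(t), .), compactness of the velocities makes the
   bound stable near (t, x(t)), and it passes to the limit as a bound on the backward difference
   quotients of <x, p> + u. By Fatou's lemma, u lies below the absolutely continuous function w with
   w(t0) = u(t0) whose derivative comes from the upper limit of the backward quotients of u. Since L
   is convex and lower semicontinuous in v, it is the supremum of its affine minorants, and
   L(t, x, x') <= -w' a.e. Finally, L5 and Gronwall's inequality keep x in the ball. *)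
Require Import Defs.
From HB Require Import structures.
From mathcomp Require Import all_boot all_order all_algebra.
From mathcomp Require Import all_classical all_reals all_analysis.
From mathcomp Require Import measurable_realfun.
From mathcomp Require Import ring lra.
Import Order.TTheory GRing.Theory Num.Theory.
Import numFieldNormedType.Exports.
Set Implicit Arguments. Unset Strict Implicit. Unset Printing Implicit Defensive.
Local Open Scope classical_set_scope.
Local Open Scope ring_scope.

(** * Lipschitz functions as integrals of their derivatives *)

Section stieltjes_density.
Context {R : realType}.
Notation mu := (@lebesgue_measure R).

(** Both measures come from covers by half-open intervals, and on each such interval the [g]-length
    is at most [K] times the length. A cover of Lebesgue content below [e / K] thus has [g]-content
    below [e]. *)
Lemma lebesgue_stieltjes_dominated (g : cumulative R R) (K : R) : 0 < K ->
  (forall s t, s <= t -> g t - g s <= K * (t - s)) ->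
  lebesgue_stieltjes_measure g `<< mu.
Proof.
move=> K0 gK; apply/null_content_dominatesP => A mA A0.
apply/eqP; rewrite eq_le measure_ge0 andbT; apply/lee_addgt0Pr => e e0.
rewrite add0e.
have : (mu A < (e / K)%:E)%E by rewrite A0 lte_fin divr_gt0.
rewrite {1}/lebesgue_measure /lebesgue_stieltjes_measure /measure_extension /mu_ext.
move=> /ereal_inf_lt[_ [F [mF AF] <-]] FeK.
apply: (@le_trans _ _ (\sum_(0 <= k <oo) wlength g (F k)))%E.
  by apply: ereal_inf_lbound; exists F.
apply: (@le_trans _ _ (\sum_(0 <= k <oo) (K%:E * wlength idfun (F k))))%E.
  apply: lee_nneseries => [i _ _|i _]; first exact: wlength_ge0.
  have /ocitvP[->|[x x12 ->]] := mF i; first by rewrite !wlength0 mule0.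
  rewrite (wlength_itv_bnd g _ _ (ltW x12)) (wlength_itv_bnd idfun _ _ (ltW x12)).
  by rewrite -EFinM lee_fin gK// ltW.
rewrite nneseriesZl => [|i _]; last exact: wlength_ge0.
by rewrite -lee_pdivlMl// -EFinM mulrC ltW.
Qed.

(** The density is the Radon-Nikodym derivative of the Stieltjes measure of [g]. Constancy of [g]
    outside a bounded interval makes that measure finite. *)
Lemma nondecreasing_lipschitz_density (g : R -> R) (K a b : R) : 0 < K ->
  {homo g : x y / x <= y} ->
  (forall s t, s <= t -> g t - g s <= K * (t - s)) ->
  (forall t, t <= a -> g t = g a) -> (forall t, b <= t -> g t = g b) ->
  exists2 f : R -> R, mu.-integrable setT (EFin \o f) &
    forall s t, s <= t -> g t - g s = \int[mu]_(r in `]s, t]) f r.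
Proof.
move=> K0 ndg gK ga gb.
have gc : continuous g.
  move=> x; apply/cvgrPdist_lt => e e0; near=> y.
  have h : `|x - y| < e / K by near: y; apply: cvgr_dist_lt => //; exact: divr_gt0.
  have [xy|yx] := leP x y.
    rewrite distrC ger0_norm ?subr_ge0 ?ndg//.
    apply: (le_lt_trans (gK _ _ xy)); rewrite -ltr_pdivlMl// mulrC.
    by rewrite -(@ger0_norm _ (y - x)) ?subr_ge0// distrC.
  have {}yx := ltW yx; rewrite ger0_norm ?subr_ge0 ?ndg//.
  apply: (le_lt_trans (gK _ _ yx)); rewrite -ltr_pdivlMl// mulrC.
  by rewrite -(@ger0_norm _ (x - y)) ?subr_ge0.
have ndg' s t : s <= t -> g s <= g t by exact: ndg.
pose cg := isCumulative.Build R _ R g ndg (right_continuousW gc).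
pose G : cumulative R R := HB.pack g cg.
pose nu := lebesgue_stieltjes_measure G.
have nuE (s t : R) : s <= t -> nu `]s, t]%classic = (g t - g s)%:E.
  move=> st; rewrite /nu /lebesgue_stieltjes_measure /measure_extension.
  by rewrite measurable_mu_extE//= ?wlength_itv_bnd//; exact: is_ocitv.
have nufin : fin_num_fun nu.
  (* [a] and [b] are not assumed to be ordered, hence the minimum and the maximum. *)
  have ab t : g (Num.min a b) <= g t <= g (Num.max a b).
    apply/andP; split.
      have [h|/ltW h] := leP (Num.min a b) t; first exact: ndg'.
      by rewrite (ga (Num.min _ _)) ?ge_min ?lexx// (ga t)// (le_trans h)// ge_min lexx.
    have [h|/ltW h] := leP t (Num.max a b); first exact: ndg'.
    by rewrite (gb (Num.max _ _)) ?le_max ?lexx ?orbT// (gb t)// (le_trans _ h)// le_max lexx orbT.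
  have nuT : (nu [set: R] <= (g (Num.max a b) - g (Num.min a b))%:E)%E.
    pose F (n : nat) := `](- n%:R : R), n%:R]%classic.
    have FT : \bigcup_n F n = setT by rewrite bigcup_itvT.
    have ndF : nondecreasing_seq F.
      move=> m n mn; apply/subsetPset => x; rewrite /F /= !in_itv/= => /andP[h1 h2].
      have mnR : m%:R <= n%:R :> R by rewrite ler_nat.
      by apply/andP; split; lra.
    have := nondecreasing_cvg_mu (mu := nu) (F := F) (fun n => measurable_itv _).
    rewrite FT => /(_ measurableT ndF) nuF.
    apply: (@le_trans _ _ (limn (nu \o F))); first by rewrite (cvg_lim _ nuF).
    apply: lime_le; first by apply/cvg_ex; eexists; exact: nuF.
    apply: nearW => n /=; rewrite nuE; last by rewrite (@le_trans _ _ 0)// oppr_le0.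
    rewrite lee_fin; have /andP[_ ?] := ab n%:R; have /andP[? _] := ab (- n%:R).
    by lra.
  move=> A mA; rewrite ge0_fin_numE; last exact: measure_ge0.
  apply: le_lt_trans; last exact: (ltry (g (Num.max a b) - g (Num.min a b))).
  apply: le_trans nuT; apply: le_measure; rewrite ?inE//.
pose nf := Measure_isFinite.Build _ _ _ nu nufin.
pose nu' : {finite_measure set (measurableTypeR R) -> \bar R} := HB.pack nu nf.
have dom : nu' `<< mu by exact: (@lebesgue_stieltjes_dominated G K).
have [f [f0 ffin fint fE]] := radon_nikodym_sigma_finite dom.
exists (fine \o f).
  by apply: eq_integrable fint => // x _ /=; rewrite fineK.
move=> s t st; rewrite /Rintegral.
under eq_integral do rewrite /= fineK//.
by rewrite -fE//= nuE.
Unshelve. all: by end_near. Qed.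

(** Up to an additive constant [f] is the integral of [d] from minus infinity, to which Lebesgue
    differentiation applies. *)
Lemma integral_ae_is_derive (f d : R -> R) : mu.-integrable setT (EFin \o d) ->
  (forall s t, s <= t -> f t - f s = \int[mu]_(r in `]s, t]) d r) ->
  {ae mu, forall t, is_derive (t : R) (1 : R) f (d t)}.
Proof.
move=> di dE.
have li : locally_integrable setT d.
  by have := integrable_locally measurableT di; rewrite patch_setT.
have dii y : mu.-integrable `]-oo, y] (EFin \o d).
  exact: integrableS di.
pose D (t : R) := \int[mu]_(r in `]-oo, t]) d r.
have fE : f = D \+ cst (f 0 - D 0).
  apply/funext => s /=.
  have [as_|/ltW sa] := leP 0 s.
    have := @Rintegral_itvB R _ _ _ 0 (dii s); rewrite !bnd_simp -dE// => /(_ isT as_).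
    by rewrite -/(D 0) -/(D s); lra.
  have := @Rintegral_itvB R _ _ _ s (dii 0); rewrite !bnd_simp -dE// => /(_ isT sa).
  by rewrite -/(D 0) -/(D s); lra.
have : {ae mu, forall t : R, derivable D t 1 /\ derive1 D t = d t} by exact: FTC1Ny.
apply: filterS; first exact: (ae_filter_ringOfSetsType mu).
move=> t [dt dtE]; rewrite fE.
have h : is_derive t (1 : R) D (d t) by apply: (DeriveDef dt); rewrite -derive1E; exact: dtE.
by rewrite -[X in is_derive _ _ _ X]addr0; exact: is_deriveD.
Qed.

(** With [cl] the projection onto [[a, b]], [f] is the difference of the nondecreasing functions
    [f + K * cl] and [K * cl]. Using [cl] instead of the identity keeps both constant outside
    [[a, b]]. *)
Lemma lipschitz_density (f : R -> R) (K a b : R) : 0 < K -> a <= b ->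
  (forall s t, `|f t - f s| <= K * `|t - s|) ->
  (forall t, t <= a -> f t = f a) -> (forall t, b <= t -> f t = f b) ->
  exists d : R -> R, [/\ mu.-integrable setT (EFin \o d),
    forall s t, s <= t -> f t - f s = \int[mu]_(r in `]s, t]) d r &
    {ae mu, forall t, is_derive (t : R) (1 : R) f (d t)}].
Proof.
move=> K0 ab fK fa fb.
pose cl (t : R) := if t <= a then a else if b <= t then b else t.
have cl_nd s t : s <= t -> 0 <= cl t - cl s <= t - s.
  by move=> st; rewrite /cl; repeat case: ifPn => ?; lra.
have fcl t : f t = f (cl t).
  by rewrite /cl; case: ifPn => ?; [exact: fa|]; case: ifPn => // ?; exact: fb.
have dens (h : R -> R) (k : R) : (forall s t, s <= t -> 0 <= h t - h s <= k * (t - s)) ->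
    0 < k -> (forall t, h t = h (cl t)) ->
    exists2 d : R -> R, mu.-integrable setT (EFin \o d) &
    forall s t, s <= t -> h t - h s = \int[mu]_(r in `]s, t]) d r.
  move=> hk k0 hcl; apply: (@nondecreasing_lipschitz_density h k a b) => //.
  - by move=> s t /hk; lra.
  - by move=> s t /hk/andP[].
  - move=> t ta; rewrite hcl [RHS]hcl; congr h; rewrite /cl.
    by repeat case: ifPn => ?; lra.
  - move=> t ta; rewrite hcl [RHS]hcl; congr h; rewrite /cl.
    by repeat case: ifPn => ?; lra.
have clcl t : cl (cl t) = cl t.
  by rewrite [cl t]/cl; case: ifPn => ?; [|case: ifPn => ?]; rewrite /cl;
    repeat case: ifPn => ?; lra.
have [d1 d1i d1E] : exists2 d : R -> R, mu.-integrable setT (EFin \o d) &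
    forall s t, s <= t -> (f t + K * cl t) - (f s + K * cl s) = \int[mu]_(r in `]s, t]) d r.
  apply: (dens (fun t => f t + K * cl t) (2 * K)); last 2 first.
  - by rewrite mulr_gt0.
  - by move=> t; rewrite clcl -fcl.
  move=> s t st; have /andP[h1 h2] := cl_nd _ _ st.
  have := fK (cl s) (cl t); rewrite -!fcl (ger0_norm h1) ler_norml => /andP[h3 h4].
  have : K * (cl t - cl s) <= K * (t - s) by rewrite ler_wpM2l// ltW.
  by lra.
have [d2 d2i d2E] : exists2 d : R -> R, mu.-integrable setT (EFin \o d) &
    forall s t, s <= t -> K * cl t - K * cl s = \int[mu]_(r in `]s, t]) d r.
  apply: (dens (fun t => K * cl t) K) => //; last by move=> t; rewrite clcl.
  move=> s t st; have /andP[h1 h2] := cl_nd _ _ st.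
  by rewrite -mulrBr (mulr_ge0 (ltW K0) h1)/= (ler_wpM2l (ltW K0) h2).
have di : mu.-integrable setT (EFin \o (d1 \- d2)).
  by rewrite (_ : _ \o _ = (EFin \o d1) \- (EFin \o d2))%E //; exact: integrableB.
have dE s t : s <= t -> f t - f s = \int[mu]_(r in `]s, t]) (d1 \- d2) r.
  move=> st; rewrite RintegralB//; last 2 first.
  - exact: integrableS d1i.
  - exact: integrableS d2i.
  by rewrite -d1E// -d2E//; ring.
exists (d1 \- d2); split => //.
exact: integral_ae_is_derive.
Qed.
End stieltjes_density.

(** * Integrals of backward difference quotients of monotone functions *)

Section monotone_quotients.
Context {R : realType}.
Notation mu := (@lebesgue_measure R).

Lemma lebesgue_measure_translation (c : R) (A : set R) : measurable A ->
  pushforward mu (fun x : R => x + c : measurableTypeR R) A = mu A.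
Proof.
move=> mA; apply/esym; apply: lebesgue_measure_unique => //= [|mf X].
  exact: measurable_funD.
move=> /ocitvP[->|[x x12 ->]]; first by rewrite !measure0.
rewrite /pushforward.
have -> : (fun y : R => y + c : measurableTypeR R) @^-1` `]x.1, x.2]%classic =
  `]x.1 - c, x.2 - c]%classic.
  by apply/seteqP; split=> y /=; rewrite !in_itv/= => /andP[? ?]; apply/andP; split; lra.
rewrite !lebesgue_measure_itv/= !lte_fin x12 ltrD2r x12 -!EFinB.
by congr (_%:E); ring.
Qed.

Lemma ge0_integral_translation (c : R) (A : set R) (f : R -> \bar R) :
  measurable A -> measurable_fun [set: R] f -> (forall x, 0 <= f x)%E ->
  (\int[mu]_(x in A) f x = \int[mu]_(x in [set x | A (x + c)%R]) f (x + c)%R)%E.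
Proof.
move=> mA mf f0.
have mt : measurable_fun [set: measurableTypeR R] (fun x : R => x + c : measurableTypeR R).
  exact: measurable_funD.
rewrite -(@ge0_integral_pushforward _ _ (measurableTypeR R) (measurableTypeR R) R _ mt mu A f)//; last first.
  exact: measurable_funS mf.
by apply: eq_measure_integral => B mB _; exact/esym/lebesgue_measure_translation.
Qed.

Lemma limn_einf_le_cst (u : nat -> \bar R) (l : \bar R) :
  (forall n, u n <= l)%E -> (limn_einf u <= l)%E.
Proof.
move=> ul; rewrite limn_einf_lim; apply: lime_le; first exact: is_cvg_einfs.
apply: nearW => n; apply: le_trans (ul n); apply: ereal_inf_lbound.
by exists n => //=.
Qed.

Lemma limn_einf_ge0 (u : nat -> \bar R) :
  (forall n, 0 <= u n)%E -> (0 <= limn_einf u)%E.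
Proof.
move=> u0; rewrite limn_einf_lim; apply: lime_ge; first exact: is_cvg_einfs.
by apply: nearW => n; apply: le_ereal_inf_tmp => _ [k _ <-].
Qed.

Lemma limn_einf_lt_frequently (u : nat -> \bar R) (l : \bar R) (n : nat) :
  (limn_einf u < l)%E -> exists2 k, (n <= k)%N & (u k < l)%E.
Proof.
rewrite limn_einf_lim (cvg_lim _ (@cvg_einfs_sup _ u))// => ul.
have : (einfs u n < l)%E.
  by apply: le_lt_trans ul; apply: ereal_sup_ubound; exists n.
by move=> /ereal_inf_lt[_ [k /= nk <-]] ukl; exists k.
Qed.

(** After a translation, the integral of [G t - G (t - h)] reduces to the integral over the last
    stretch of length [h], at most [h * (G b - G a)] once [G a] has been subtracted from [G]. *)
Lemma integral_backward_quotient (G : R -> R) (a b h : R) : 0 < h -> a <= b ->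
  {homo G : x y / x <= y} -> (forall t, t <= a -> G t = G a) ->
  (\int[mu]_(t in `[a, b]) ((G t - G (t - h)) / h)%:E <= (G b - G a)%:E)%E.
Proof.
move=> h0 ab ndG Ga.
(* Subtracting [G a] makes the integrand nonnegative, so that all integrals below are of nonnegative
   functions. *)
pose G1 t := G t - G a.
have G10 t : 0 <= G1 t.
  rewrite /G1 subr_ge0; have [ta|/ltW at_] := leP t a; first by rewrite (Ga t).
  exact: ndG.
have mG1 : measurable_fun [set: R] G1.
  by apply: nondecreasing_measurable => // s t st; rewrite lerD2r ndG.
have mE : measurable_fun [set: R] (EFin \o G1) by exact/measurable_EFinP.
have mG1h : measurable_fun [set: R] (fun t : R => G1 (t - h)).
  apply: (measurableT_comp mG1); exact: measurable_funD.
have mEh : measurable_fun [set: R] (fun t : R => (G1 (t - h))%:E) by exact/measurable_EFinP.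
pose q t := (G t - G (t - h)) / h.
have q0 t : 0 <= q t by rewrite divr_ge0 ?(ltW h0)// subr_ge0 ndG// gerBl ltW.
have mq : measurable_fun [set: R] (fun t => (q t)%:E).
  apply/measurable_EFinP; apply: measurable_funM => //.
  rewrite (_ : (fun t => _) = (fun t => G1 t - G1 (t - h))).
    exact: measurable_funB.
  by apply/funext => t; rewrite /G1; ring.
have finI (s t : R) : (\int[mu]_(x in `[s, t]) (G1 x)%:E)%E \is a fin_num.
  rewrite ge0_fin_numE; last by apply: integral_ge0 => x _; rewrite lee_fin.
  apply: (@le_lt_trans _ _ (\int[mu]_(x in `[s, t]) (G1 t)%:E)%E).
    apply: ge0_le_integral => //.
    - by move=> x _; rewrite lee_fin.
    - exact: measurable_funS mE.
    - by move=> x /=; rewrite in_itv/= => /andP[_ xt]; rewrite lee_fin lerD2r ndG.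
  rewrite integral_cst//= lebesgue_measure_itv/=.
  by case: ifPn => _; rewrite ?mule0 ?ltry// -EFinB -EFinM ltry.
(* Stated as a sum, since integrals in the extended reals are not freely subtracted; [finI] later
   allows the cancellation. *)
have E1 : (\int[mu]_(t in `[a, b]) (h * q t)%:E +
    \int[mu]_(t in `[(a - h)%R, (b - h)%R]) (G1 t)%:E = \int[mu]_(t in `[a, b]) (G1 t)%:E)%E.
  have -> : (\int[mu]_(t in `[(a - h)%R, (b - h)%R]) (G1 t)%:E =
      \int[mu]_(t in `[a, b]) (G1 (t - h))%:E)%E.
    rewrite (@ge0_integral_translation (- h))//.
    congr integral; apply/seteqP; split=> y /=; rewrite !in_itv/= => /andP[? ?];
      by apply/andP; split; lra.
  rewrite -ge0_integralD//; last 4 first.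
  - by move=> t _; rewrite lee_fin mulr_ge0 ?(ltW h0).
  - apply/measurable_EFinP; apply: measurable_funM => //.
    by apply/measurable_EFinP; exact: measurable_funS mq.
  - by move=> t _; rewrite lee_fin.
  - exact: measurable_funS mEh.
  apply: eq_integral => t _; rewrite -EFinD; congr (_%:E).
  by rewrite /q /G1; field; rewrite gt_eqF.
have E2 : (\int[mu]_(t in `[a, b]) (G1 t)%:E <=
    (h * G1 b)%:E + \int[mu]_(t in `[(a - h)%R, (b - h)%R]) (G1 t)%:E)%E.
  apply: (@le_trans _ _ (\int[mu]_(t in `](b - h)%R, b] `|` `[(a - h)%R, (b - h)%R]) (G1 t)%:E)%E).
    apply: ge0_subset_integral => //.
    - exact: measurableU.
    - exact: measurable_funS mE.
    - by move=> x _; rewrite lee_fin.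
    move=> x /=; rewrite !in_itv/= => /andP[ax xb].
    by have [?|?] := leP x (b - h); [right|left]; apply/andP; split; lra.
  rewrite ge0_integral_setU//; last 3 first.
  - exact: measurable_funS mE.
  - by move=> x _; rewrite lee_fin.
  - apply/disj_setPS => x /=; rewrite !in_itv/= => -[/andP[h1 h2] /andP[h3 h4]]; lra.
  apply: leeD => //.
  apply: (@le_trans _ _ (\int[mu]_(x in `](b - h)%R, b]) (G1 b)%:E)%E).
    apply: ge0_le_integral => //.
    - by move=> x _; rewrite lee_fin.
    - exact: measurable_funS mE.
    - by move=> x /=; rewrite in_itv/= => /andP[_ xt]; rewrite lee_fin lerD2r ndG.
  rewrite integral_cst//= lebesgue_measure_itv/= lte_fin ltrBlDr ltrDl h0.
  by rewrite -EFinB -EFinM lee_fin le_eqVlt; apply/orP; left; apply/eqP; ring.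
move: E2; rewrite -E1 leeD2rE; last exact: finI.
rewrite (_ : (fun t => _) = (fun t => h%:E * (q t)%:E)%E); last first.
  by apply/funext => t; rewrite EFinM.
rewrite ge0_integralZl//; last 3 first.
- exact: measurable_funS mq.
- by move=> t _; rewrite lee_fin.
- by rewrite lee_fin ltW.
by rewrite EFinM lee_pmul2l.
Qed.

(** Fatou's lemma applies as the quotients are nonnegative. Only an inequality survives: jumps and
    the singular part of [G] are lost in the lower limit. *)
Lemma fatou_backward_quotient (G : R -> R) (a b : R) : a <= b ->
  {homo G : x y / x <= y} -> (forall t, t <= a -> G t = G a) ->
  (\int[mu]_(t in `[a, b])
     limn_einf (fun n => ((G t - G (t - n.+1%:R^-1)) / n.+1%:R^-1)%:E)
   <= (G b - G a)%:E)%E.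
Proof.
move=> ab ndG Ga.
apply: le_trans; first apply: (@fatou _ _ _ mu `[a, b]%classic _ (fun n t => ((G t - G (t - n.+1%:R^-1)) / n.+1%:R^-1)%:E)) => //.
- move=> n; apply/measurable_EFinP; apply: measurable_funM => //.
  apply: measurable_funB; first exact: nondecreasing_measurable.
  apply: measurableT_comp; first exact: nondecreasing_measurable.
  exact: measurable_funD.
- by move=> n t _; rewrite lee_fin divr_ge0// subr_ge0 ndG// gerBl.
by apply: limn_einf_le_cst => n; exact: integral_backward_quotient.
Qed.

End monotone_quotients.

(** * Absolute continuity of indefinite integrals *)

Section absolute_continuity.
Context {R : realType}.
Notation mu := (@lebesgue_measure R).

Lemma integral_small (f : R -> R) (e : R) : 0 < e ->
  mu.-integrable setT (EFin \o f) ->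
  exists2 d : R, 0 < d & forall A : set R, measurable A -> (mu A < d%:E)%E ->
    (\int[mu]_(x in A) `|f x|%:E < e%:E)%E.
Proof.
move=> e0 fi.
have [d [d0 small]] := @integral_normr_continuous _ (measurableTypeR R) R mu f fi e e0.
exists d => // A mA Ad; have := small A mA Ad; rewrite -lte_fin /Rintegral fineK//.
have fA : mu.-integrable A (EFin \o f) by exact: integrableS fi.
exact: integrable_fin_num (integrable_abse fA).
Qed.

Lemma normr_increment_le (f F : R -> R) (s t : R) : s <= t ->
  mu.-integrable setT (EFin \o f) -> F t - F s = \int[mu]_(r in `]s, t]) f r ->
  (`|F t - F s|%:E <= \int[mu]_(r in `]s, t]) `|f r|%:E)%E.
Proof.
move=> st fi ->.
have Ji : mu.-integrable `]s, t] (EFin \o f) by apply: integrableS fi.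
apply: (@le_trans _ _ (\int[mu]_(r in `]s, t]) `|f r|)%:E).
  by rewrite lee_fin; exact: le_normr_Rintegral.
rewrite /Rintegral fineK//; apply: integrable_fin_num => //.
exact: integrable_abse Ji.
Qed.

(** The increments over disjoint intervals add up to at most the integral of [|f|] over their union,
    a set of small measure. *)
Lemma abs_cont_integral (f F : R -> R) (a b : R) :
  mu.-integrable setT (EFin \o f) ->
  (forall s t, s <= t -> F t - F s = \int[mu]_(r in `]s, t]) f r) ->
  abs_cont a b F.
Proof.
move=> fi FE e e0; have [d d0 small] := integral_small e0 fi.
exists d => // n s t st disj sum_d.
have mf : measurable_fun [set: R] f by apply/measurable_EFinP; exact: measurable_int fi.
have mnf : measurable_fun [set: R] (fun x => `|f x|%:E).
  by apply/measurable_EFinP; exact: measurableT_comp.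
(* Half-open intervals stay disjoint even when two of them share an endpoint. *)
pose J (i : 'I_n) := `]s i, t i]%classic.
have mJ i : measurable (J i) by exact: measurable_itv.
have trJ : trivIset [set` index_enum 'I_n] J.
  apply/trivIsetP => i j _ _ ij; apply/seteqP; split => // x.
  rewrite /J /= !in_itv/= => -[/andP[h1 h2] /andP[h3 h4]].
  have [|] := disj i j (ltn_ord i) (ltn_ord j) (fun h => negP ij (introT eqP (val_inj h))).
    by move=> h; lra.
  by move=> h; lra.
pose D := \big[setU/set0]_(i <- index_enum 'I_n) J i.
have mD : measurable D by exact: bigsetU_measurable.
have muD : (mu D < d%:E)%E.
  (* The measure of the union is read as the integral of 1, so that additivity of the integral also
     serves here. *)
  rewrite -[mu D]mul1e -(integral_cst mu mD 1).
  rewrite ge0_integral_bigsetU//; last exact: index_enum_uniq.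
  apply: (@le_lt_trans _ _ (\sum_(i <- index_enum 'I_n) (t i - s i)%:E)%E).
    apply: lee_sum => i _.
    have -> : (\int[mu]_(x in J i) cst 1%:E x)%E = mu (J i).
      by rewrite -[RHS]mul1e -(integral_cst mu (mJ i) 1).
    rewrite lebesgue_measure_itv/=.
    have [_ [sti _]] := st i (ltn_ord i).
    by rewrite lte_fin sti -EFinB.
  by rewrite sumEFin lte_fin.
have := small _ mD muD; rewrite ge0_integral_bigsetU//; last 2 first.
- exact: index_enum_uniq.
- exact: measurable_funS mnf.
rewrite -lte_fin; apply: le_lt_trans; rewrite -sumEFin; apply: lee_sum => i _.
have [_ [sti _]] := st i (ltn_ord i).
by apply: normr_increment_le fi (FE _ _ _); exact: ltW.
Qed.
End absolute_continuity.

(** * Euclidean geometry and compact balls in the space of row vectors *)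

#[local] Instance row_nbhs_pfilter (R : realType) (N : nat) (x : 'rV[R]_N) :
  ProperFilter (nbhs x).
Proof. exact: nbhs_pfilter. Qed.

(* On row vectors [`|x|] is the sup norm; [enorm] is the Euclidean norm. *)
Section euclidean.
Context {R : realType} {N : nat}.
Implicit Types (x y z : 'rV[R]_N) (a : R).

Lemma dotvC x y : dotv x y = dotv y x.
Proof. by apply: eq_bigr => i _; rewrite mulrC. Qed.

Lemma dotvDl x y z : dotv (x + y) z = dotv x z + dotv y z.
Proof. by rewrite -big_split; apply: eq_bigr => i _; rewrite !mxE mulrDl. Qed.

Lemma dotvZl a x y : dotv (a *: x) y = a * dotv x y.
Proof. by rewrite /dotv mulr_sumr; apply: eq_bigr => i _; rewrite !mxE mulrA. Qed.

Lemma dotvNl x y : dotv (- x) y = - dotv x y.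
Proof. by rewrite -scaleN1r dotvZl mulN1r. Qed.

Lemma dotv0l x : dotv 0 x = 0.
Proof. by rewrite -[X in dotv X _](scale0r 0) dotvZl mul0r. Qed.

Lemma dotvDr x y z : dotv z (x + y) = dotv z x + dotv z y.
Proof. by rewrite !(dotvC z) dotvDl. Qed.

Lemma dotvZr a x y : dotv y (a *: x) = a * dotv y x.
Proof. by rewrite !(dotvC y) dotvZl. Qed.

Lemma dotvNr x y : dotv y (- x) = - dotv y x.
Proof. by rewrite !(dotvC y) dotvNl. Qed.

Lemma dotvBB x y : dotv (x - y) (x - y) = dotv x x - 2 * dotv x y + dotv y y.
Proof.
by rewrite dotvDl dotvNl !dotvDr !dotvNr (dotvC y x); ring.
Qed.

Lemma dotv_ge0 x : 0 <= dotv x x.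
Proof. by apply: sumr_ge0 => i _; rewrite -expr2 sqr_ge0. Qed.

Lemma row_norm_coord x i : `|x 0 i| <= `|x|.
Proof.
by rewrite [leRHS]/Num.Def.normr/= mx_normrE; apply: le_trans (le_bigmax _ _ (0, i)).
Qed.

Lemma row_norm_le x a : 0 <= a -> (forall i, `|x 0 i| <= a) -> `|x| <= a.
Proof.
move=> a0 xa; rewrite [leLHS]/Num.Def.normr/= mx_normrE.
by apply: bigmax_le => // -[i j] _; rewrite (ord1 i) xa.
Qed.

Lemma normv_sqr_le_dotv x : `|x| ^+ 2 <= dotv x x.
Proof.
rewrite -[leRHS]sqr_sqrtr ?dotv_ge0// ler_sqr ?nnegrE ?sqrtr_ge0//.
apply: row_norm_le => [|i]; first exact: sqrtr_ge0.
rewrite -[leLHS]sqrtr_sqr ler_wsqrtr// expr2 /dotv (bigD1 i)//= lerDl.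
by apply: sumr_ge0 => j _; rewrite -expr2 sqr_ge0.
Qed.

Lemma normv_le_enorm x : `|x| <= enorm x.
Proof.
rewrite -(@ler_sqr R) ?nnegrE ?sqrtr_ge0// sqr_sqrtr ?dotv_ge0//.
exact: normv_sqr_le_dotv.
Qed.

Lemma dotv_le_norm x y : `|dotv x y| <= N%:R * (`|x| * `|y|).
Proof.
apply: le_trans (ler_norm_sum _ _ _) _.
apply: (@le_trans _ _ (\sum_(i < N) (`|x| * `|y|))).
  by apply: ler_sum => i _; rewrite normrM ler_pM// row_norm_coord.
by rewrite sumr_const card_ord -[leLHS]mulr_natl lexx.
Qed.

Lemma enorm_le_normv x : enorm x <= N%:R * `|x|.
Proof.
rewrite -(@ler_sqr R) ?nnegrE ?sqrtr_ge0 ?mulr_ge0// sqr_sqrtr ?dotv_ge0//.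
apply: (le_trans (ler_norm _)); apply: (le_trans (dotv_le_norm _ _)).
rewrite exprMn -expr2 ler_wpM2r ?sqr_ge0// -natrX ler_nat.
by case: N => // n; rewrite expnS leq_pmulr.
Qed.

Lemma cvg_dotv (I : Type) (F : set_system I) (f g : I -> 'rV[R]_N) x y : Filter F ->
  f @ F --> x -> g @ F --> y -> dotv (f i) (g i) @[i --> F] --> dotv x y.
Proof.
move=> FF fx gy; apply: cvg_big => [|i _]; first exact: add_continuous.
by apply: cvgM; [exact: (cvg_comp _ _ fx (@coord_continuous _ _ _ _ _ _))|
                 exact: (cvg_comp _ _ gy (@coord_continuous _ _ _ _ _ _))].
Qed.

Lemma continuous_sqdist y : continuous (fun x => dotv (x - y) (x - y)).
Proof.
move=> x; have h : x' - y @[x' --> x] --> x - y.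
  by apply: cvgB; [exact: cvg_id|exact: cvg_cst].
exact: cvg_dotv.
Qed.

Lemma compact_normv_ball (a : R) : compact [set x : 'rV[R]_N | `|x| <= a].
Proof.
apply: bounded_closed_compact.
  exists a; split; first exact: num_real.
  by move=> M aM x /= xa; exact: le_trans xa (ltW aM).
apply: (@closed_comp _ _ (fun x : 'rV[R]_N => `|x|) [set r | r <= a]).
  by move=> x _; exact: norm_continuous.
exact: closed_le.
Qed.
End euclidean.

(** * Lower semicontinuous extended-real functions on compact sets *)

Section lsc_compact.
Context {R : realType} {X : topologicalType}.
Implicit Types (K : set X) (f : X -> \bar R).

Lemma lte_real_dense (a : R) (l : \bar R) : (a%:E < l)%E ->
  exists2 b : R, a < b & (b%:E < l)%E.
Proof.
case: l => [r| |//]; first by rewrite lte_fin => ar; exists ((a + r) / 2); rewrite ?lte_fin; lra.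
by move=> _; exists (a + 1); [lra|exact: ltry].
Qed.

(** Suppose that there is no minimiser. Then near each point of [K], [f] exceeds [f i] for all [i]
    far enough down in the filter of sublevel sets. By compactness one such [i] serves all of [K],
    and [f i < f i]. *)
Lemma compact_lsc_min K f : compact K -> K !=set0 ->
  (forall p, K p -> forall a : R, (a%:E < f p)%E ->
    \forall q \near p, K q -> (a%:E < f q)%E) ->
  exists2 p, K p & forall q, K q -> (f p <= f q)%E.
Proof.
move=> /compact_near_coveringP cK [p0 Kp0] fl; apply: contrapT => nomin.
have {nomin} lower p : K p -> exists2 q, K q & (f q < f p)%E.
  move=> Kp; apply: contrapT => h; apply: nomin; exists p => // q Kq.
  by rewrite leNgt; apply/negP => fqp; apply: h; exists q.
pose F : set_system X := filter_from K (fun q => [set q' | K q' /\ (f q' <= f q)%E]).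
have FF : Filter F.
  apply: filter_from_filter; first by exists p0.
  move=> i j Ki Kj; have [ij|/ltW ji] := leP (f i) (f j).
    by exists i => // q [Kq qi]; split=> //; split => //; exact: le_trans qi ij.
  by exists j => // q [Kq qi]; split=> //; split => //; exact: le_trans qi ji.
have := cK X F (fun i q => K q -> (f i < f q)%E) FF.
case.
  move=> p Kp; have [q Kq fqp] := lower p Kp.
  (* Semicontinuity is phrased with real levels, so a real is inserted between two possibly infinite
     values. *)
  have [a fqa afp] : exists2 a : R, (f q <= a%:E)%E & (a%:E < f p)%E.
    move: fqp; case: (f q) => [r| |].
    - by move=> rp; exists r.
    - by rewrite ltNge leey.
    case: (f p) => [r| |//].
      by move=> _; exists (r - 1); rewrite ?leNye// lte_fin; lra.
    by move=> _; exists 0; rewrite ?leNye// ltry.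
  exists ([set q' | K q' -> (a%:E < f q')%E], [set i | K i /\ (f i <= f q)%E]) => /=.
    by split; [exact: fl|exists q].
  move=> [x i] /= [xa [Ki iq]] Kx; exact: le_lt_trans iq (le_lt_trans fqa (xa Kx)).
move=> i Ki sub; have := sub i (conj Ki (lexx _)) i Ki Ki.
by rewrite ltxx.
Qed.

Lemma lsc_add_continuous K f (g : X -> R) p (a : R) :
  (forall a : R, (a%:E < f p)%E -> \forall q \near p, K q -> (a%:E < f q)%E) ->
  {for p, continuous g} -> (a%:E < f p + (g p)%:E)%E ->
  \forall q \near p, K q -> (a%:E < f q + (g q)%:E)%E.
Proof.
move=> fl gc; rewrite -lteBlDr// -EFinB => /lte_real_dense[b ab bf].
near=> q; move=> Kq.
have h1 : (b%:E < f q)%E by move: Kq; near: q; exact: fl.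
have h2 : a - b < g q by near: q; apply: (cvgr_gt (g p)) => //; lra.
by rewrite -lteBlDr// -EFinB; apply: lt_trans h1; rewrite lte_fin; lra.
Unshelve. all: by end_near. Qed.

End lsc_compact.

(** * Lower bounds and affine minorants of the Lagrangian *)

Section lagrangian.
Context {R : realType} {N : nat} (T : R) (L : R -> 'rV[R]_N -> 'rV[R]_N -> \bar R).
Implicit Types (t s : R) (x y v p : 'rV[R]_N).

Lemma L4_normv : L4 T L -> forall r : R, 0 <= r -> exists2 C : R, 0 <= C &
  forall t x v, 0 <= t <= T -> `|x| <= r -> C < `|v| -> L t x v = +oo%E.
Proof.
move=> hL r r0; have [C C0 hC] := hL (N%:R * r) (mulr_ge0 (ler0n _ _) r0).
exists C => // t x v t0T xr Cv; apply: hC => //.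
  by apply: le_trans (enorm_le_normv _) _; rewrite ler_wpM2l.
exact: lt_le_trans Cv (normv_le_enorm _).
Qed.

(** For [|v| > C] the value of [L] is infinite, and on the compact set [|v| <= C] a strict
    inequality survives small perturbations. The constant [k] is perturbed together with [(s, y)],
    which yields the margin [k' < k]. *)
Lemma affine_minorant_stable s y p (k : R) : L1 T L -> L4 T L -> 0 <= s <= T ->
  (forall v, ((dotv v p - k)%:E < L s y v)%E) ->
  exists k' r : R, [/\ k' < k, 0 < r & forall s' y' v, 0 <= s' <= T ->
    `|s' - s| < r -> `|y' - y| < r -> ((dotv v p - k')%:E < L s' y' v)%E].
Proof.
move=> hL1 hL4 sT Lk.
(* Radius [|y| + 1], so that one bound [C] serves all points within distance 1 of [y]. *)
have [C C0 hC] := L4_normv hL4 (addr_ge0 (normr_ge0 y) ler01).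
have /compact_near_coveringP cov := @compact_normv_ball R N C.
pose Z := ('rV[R]_N * (R * R * 'rV[R]_N))%type.
have cv v : \forall v' \near v & i \near ((k, s, y) : R * R * 'rV[R]_N),
    0 <= i.1.2 <= T -> ((dotv v' p - i.1.1)%:E < L i.1.2 i.2 v')%E.
  have [b vb bL] := lte_real_dense (Lk v).
  pose F := filter_prod (nbhs v) (nbhs ((k, s, y) : R * R * 'rV[R]_N)).
  have c1 : (fun z : Z => z.1) @ F --> v by exact: cvg_fst.
  have c2 : (fun z : Z => z.2) @ F --> (k, s, y) by exact: cvg_snd.
  have c3 : (fun z : Z => z.2.1) @ F --> (k, s) by apply: (cvg_comp _ _ c2); exact: cvg_fst.
  have c4 : (fun z : Z => z.2.1.1) @ F --> k by apply: (cvg_comp _ _ c3); exact: cvg_fst.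
  have c5 : (fun z : Z => z.2.1.2) @ F --> s by apply: (cvg_comp _ _ c3); exact: cvg_snd.
  have c6 : (fun z : Z => z.2.2) @ F --> y by apply: (cvg_comp _ _ c2); exact: cvg_snd.
  have H1 : \forall z \near F, 0 <= z.2.1.2 <= T -> (b%:E < L z.2.1.2 z.2.2 z.1)%E.
    exact: (cvg_pair (cvg_pair c5 c6) c1 (hL1 s y v sT b bL)).
  have c7 : (fun z : Z => dotv z.1 p - z.2.1.1) @ F --> dotv v p - k.
    by apply: cvgB => //; apply: cvg_dotv => //; exact: cvg_cst.
  have H2 : \forall z \near F, dotv z.1 p - z.2.1.1 < b by exact: (cvgr_lt _ c7).
  by apply: filterS2 H1 H2 => z h1 h2 /h1; apply: lt_trans; rewrite lte_fin.
have /nbhs_ballP[e /= e0 He] := cov _ (nbhs ((k, s, y) : R * R * 'rV[R]_N))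
  (fun i v => 0 <= i.1.2 <= T -> ((dotv v p - i.1.1)%:E < L i.1.2 i.2 v)%E)
  (nbhs_filter _) (fun v _ => cv v).
exists (k - e / 2), (Num.min 1 e); split; [lra|by rewrite lt_min ltr01|].
move=> s' y' v s'T; rewrite !lt_min => /andP[_ ss'] /andP[yy1 yy'].
have [vC|Cv] := leP `|v| C; last first.
  rewrite (hC s' y' v s'T _ Cv) ?ltry//.
  have := ler_normD (y' - y) y; rewrite subrK; move: yy1; lra.
apply: (He (k - e / 2, s', y')) => //; split; first split; rewrite -ball_normE /=.
- by rewrite opprB addrC subrK gtr0_norm; lra.
- by rewrite distrC.
- by rewrite distrC.
Qed.

(** By [L4] it is enough to minimise [L] over a compact set of times, points and velocities. *)
Lemma L_lbound (r : R) : L1 T L -> L2 T L -> L4 T L -> 0 <= r -> exists2 m : R, 0 <= m &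
  forall t x v, 0 <= t <= T -> `|x| <= r -> ((- m)%:E < L t x v)%E.
Proof.
move=> hL1 hL2 hL4 r0; have [T0|T0] := leP 0 T; last first.
  by exists 0 => // t x v /andP[h1 h2]; exfalso; lra.
have [C C0 hC] := L4_normv hL4 r0.
pose K : set (R * 'rV[R]_N * 'rV[R]_N) := (`[0, T]%classic `*` [set x : 'rV[R]_N | `|x| <= r]) `*` [set v : 'rV[R]_N | `|v| <= C].
have cK : compact K.
  apply: compact_setX; last exact: compact_normv_ball.
  by apply: compact_setX; [exact: segment_compact|exact: compact_normv_ball].
have K0 : K !=set0.
  by exists (0, 0, 0); rewrite /K /= in_itv /= lexx T0 !normr0.
have [|p Kp pmin] := @compact_lsc_min R _ K (fun p : R * 'rV[R]_N * 'rV[R]_N => L p.1.1 p.1.2 p.2) cK K0.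
  move=> [[t x] v] /= [[tT _] _] a aL; move: tT; rewrite /= in_itv/= => tT.
  have := hL1 t x v tT a aL; apply: filterS => -[[t' x'] v'] /= h [[]].
  by rewrite /= in_itv/= => /h.
have pT : 0 <= p.1.1 <= T by move: Kp => [[+ _] _]; rewrite /= in_itv.
have [_ Lny _] := hL2 p.1.1 p.1.2 pT.
have [m mL] : exists m : R, (m%:E < L p.1.1 p.1.2 p.2)%E.
  have := Lny p.2; case: (L _ _ _) => [l| |//] _; last by exists 0; rewrite ltry.
  by exists (l - 1); rewrite lte_fin; lra.
exists `|m| => // t x v tT xr.
have [vC|Cv] := leP `|v| C; last by rewrite (hC t x v tT xr Cv) ltry.
apply: (@le_lt_trans _ _ m%:E); first by rewrite lee_fin lerNl ler_normr lexx orbT.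
apply: (lt_le_trans mL); apply: (pmin (t, x, v)).
by rewrite /K /= in_itv.
Qed.

(** Separation without Hahn-Banach: let [v1] minimise [L] plus the penalty [c |v - v0|^2]. By
    convexity [p = 2c (v0 - v1)] is a subgradient of [L] at [v1]. For large [c] the resulting affine
    function exceeds [a] at [v0]. *)
Lemma L_affine_minorant t x v0 (e0 : R) : L1 T L -> L2 T L -> L4 T L ->
  0 <= t <= T -> ((- e0)%:E < L t x v0)%E ->
  exists p (k : R), (forall v, ((dotv v p - k)%:E < L t x v)%E) /\ k < dotv v0 p + e0.
Proof.
move=> hL1 hL2 hL4 tT /lte_real_dense[a e0a aL].
have [Lcvx Lny [w Lw]] := hL2 t x tT.
have [m m0 Lm] := L_lbound hL1 hL2 hL4 (normr_ge0 x).
have [C C0 hC] := L4_normv hL4 (normr_ge0 x).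
have lscL v (b : R) : (b%:E < L t x v)%E -> \forall q \near v, (b%:E < L t x q)%E.
  move=> bL; have cvv : (fun q : 'rV[R]_N => ((t, x), q)) @ v --> ((t, x), v).
    have ct : (fun q : 'rV[R]_N => t) @ nbhs v --> t.
      by apply: cvg_cst; exact: nbhs_filter.
    have cx : (fun q : 'rV[R]_N => x) @ nbhs v --> x.
      by apply: cvg_cst; exact: nbhs_filter.
    exact: (cvg_pair (cvg_pair ct cx) (@cvg_id _ (nbhs v))).
  have := cvv _ (hL1 t x v tT b bL); apply: (@filterS _ _ (nbhs_filter v)) => q /=.
  by apply.
have /nbhs_ballP[r /= r0 Hr] := lscL v0 a aL.
(* With [c * r ^+ 2 = m + |a| + 1], a minimiser at distance at least [r] from [v0] still gives a
   value above [a], because [L > - m]; within distance [r], [L] itself is above [a]. *)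
pose c : R := (m + `|a| + 1) / r ^+ 2.
have c0 : 0 < c by rewrite divr_gt0 ?exprn_gt0//; have := normr_ge0 a; lra.
pose phi v : \bar R := (L t x v + (c * dotv (v - v0) (v - v0))%:E)%E.
have wC : `|w| <= C.
  by rewrite leNgt; apply/negP => Cw; apply: Lw; exact: (hC t x w tT (lexx _) Cw).
pose K := [set v : 'rV[R]_N | `|v| <= C].
have [||v1 Kv1 v1min'] := @compact_lsc_min R _ K phi (@compact_normv_ball _ _ _).
- by exists w.
- move=> v Kv b; apply: (@lsc_add_continuous R _ K (L t x) (fun v => c * dotv (v - v0) (v - v0)) v b).
    by move=> b' /lscL; apply: (@filterS _ _ (nbhs_filter v)).
  by apply: cvgM; [exact: cvg_cst|exact: continuous_sqdist].
have v1min v : (phi v1 <= phi v)%E.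
  have [vC|Cv] := leP `|v| C; first exact: v1min'.
  by rewrite /phi (hC t x v tT (lexx _) Cv) addye// leey.
have finL v : L t x v <> +oo%E -> L t x v = (fine (L t x v))%:E.
  by have := Lny v; case: (L t x v).
have Lv1 : L t x v1 = (fine (L t x v1))%:E.
  apply: (finL) => h; have := v1min w; by rewrite /phi h (finL w Lw) addye.
pose l1 := fine (L t x v1); rewrite -/l1 in Lv1.
pose p := (2 * c) *: (v0 - v1).
have sub v (l : R) : L t x v = l%:E -> l1 + dotv (v - v1) p <= l.
  move=> Lv; pose A := l1 + dotv (v - v1) p - l.
  pose B := c * dotv (v - v1) (v - v1).
  (* Minimality of [v1] along the segment towards [v], with convexity, bounds the defect [A] in the
     subgradient inequality by a term of first order in [lam]. A small [lam] then rules out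
     [A > 0]. *)
  have AB lam : 0 < lam < 1 -> A <= lam * B.
    move=> lam01; have lam0 : 0 < lam by case/andP: lam01.
    have := le_trans (v1min (lam *: v + (1 - lam) *: v1)) (leeD2r _ (Lcvx v v1 lam lam01)).
    rewrite /phi Lv1 Lv -!EFinM -!EFinD lee_fin.
    have -> : lam *: v + (1 - lam) *: v1 - v0 = (v1 - v0) + lam *: (v - v1).
      by apply/rowP => i; rewrite !mxE; ring.
    rewrite !(dotvDl _ (lam *: _)) !(dotvDr (v1 - v0)) !dotvZl !dotvZr.
    rewrite (dotvC (v - v1) (v1 - v0)) => h.
    have {}h : lam * A <= lam * (lam * B).
      rewrite /A /B /p dotvZr -(opprB v1 v0) dotvNr (dotvC _ (v1 - v0)).
      move: h; set d1 := dotv (v1 - v0) (v1 - v0); set d2 := dotv (v1 - v0) (v - v1).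
      set d3 := dotv (v - v1) (v - v1); move=> h; lra.
    by move: h; rewrite ler_pM2l.
  have [A0|A0] := leP A 0; first by move: A0; rewrite /A; lra.
  have B0 : 0 <= B by rewrite mulr_ge0 ?(ltW c0)// dotv_ge0.
  have lb : 0 < A / (2 * (A + B)) < 1.
    rewrite divr_gt0//=; last by rewrite mulr_gt0//; lra.
    rewrite ltr_pdivrMr; last by rewrite mulr_gt0//; lra.
    by lra.
  have := AB _ lb; rewrite mulrAC ler_pdivlMr; last by rewrite mulr_gt0//; lra.
  have : 0 <= A * B by rewrite mulr_ge0 // ltW.
  have : 0 < A * A by rewrite mulr_gt0.
  by lra.
(* Lowering the affine function by [a + e0 > 0] makes it a strict minorant, and its value at [v0]
   remains above [- e0]. *)
exists p, (dotv v1 p - l1 + (a + e0)); split.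
  move=> v; have [Lv|/finL Lv] := pselect (L t x v = +oo%E); first by rewrite Lv ltry.
  rewrite Lv lte_fin; have := sub v _ Lv; rewrite dotvDl dotvNl; lra.
suff : a - l1 < dotv (v0 - v1) p by rewrite dotvDl dotvNl; lra.
rewrite /p dotvZr.
have [v1r|rv1] := ltP `|v1 - v0| r.
  have : (a%:E < L t x v1)%E by apply: Hr; rewrite -ball_normE /= distrC.
  rewrite Lv1 lte_fin => al1.
  have : 0 <= 2 * c * dotv (v0 - v1) (v0 - v1) by rewrite mulr_ge0 ?dotv_ge0// mulr_ge0// ltW.
  by lra.
have : ((- m)%:E < L t x v1)%E by exact: Lm.
rewrite Lv1 lte_fin => ml1.
have h1 : r ^+ 2 <= dotv (v0 - v1) (v0 - v1).
  apply: le_trans (normv_sqr_le_dotv _); rewrite distrC.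
  by rewrite ler_sqr ?nnegrE// ltW.
have : c * r ^+ 2 <= c * dotv (v0 - v1) (v0 - v1) by rewrite ler_wpM2l// ltW.
rewrite {1}/c divfK ?gt_eqF ?exprn_gt0// => h2.
have := ler_norm a; have := normr_ge0 a; lra.
Qed.

End lagrangian.

(** * Proximal normals to the epigraph and the velocities they provide *)

Section proximal_normals.
Context {R : realType} {N : nat}.
Implicit Types (w z d : pt R N).

Lemma dotpC w z : dotp w z = dotp z w.
Proof. by rewrite /dotp dotvC mulrC [w.2 * _]mulrC. Qed.

Lemma dotp_paddscalel w (a : R) z d :
  dotp (paddscale w a z) d = dotp w d + a * dotp z d.
Proof. by rewrite /dotp /paddscale /= dotvDl dotvZl; ring. Qed.

Lemma dotp_ge0 w : 0 <= dotp w w.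
Proof. by rewrite /dotp !addr_ge0 ?dotv_ge0// -expr2 sqr_ge0. Qed.

Lemma dotp_paddscale2 w (a : R) z : dotp (paddscale w a z) (paddscale w a z) =
  dotp w w + 2 * a * dotp w z + a ^+ 2 * dotp z z.
Proof.
rewrite dotp_paddscalel !(dotpC _ (paddscale _ _ _)) !dotp_paddscalel (dotpC z w).
by ring.
Qed.

Lemma normv_le_pnorm w : `|w.1.2| <= pnorm w.
Proof.
rewrite -(@ler_sqr R) ?nnegrE ?sqrtr_ge0// sqr_sqrtr ?dotp_ge0//.
apply: le_trans (normv_sqr_le_dotv _) _.
by rewrite /dotp addrAC lerDr addr_ge0// -expr2 sqr_ge0.
Qed.

(** If a tangent [z] had [c = <z, n> > 0], the epigraph would contain points [w + q] with [q] close
    to [tau z]. Minimality gives [<n, q> <= |q|^2 / (2 eps)], which is of order [tau^2], whereas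
    [<n, q>] is at least [tau c / 2]. *)
Lemma proximal_normal (T t s eps r : R) (x y : 'rV[R]_N) (U : R -> 'rV[R]_N -> \bar R) :
  0 < eps -> 0 <= s <= T -> U s y \is a fin_num -> `|y| < r ->
  (forall s' y', 0 <= s' <= T -> `|y'| <= r ->
    (U s y + (((t - s) ^+ 2 + dotv (x - y) (x - y)) / (2 * eps))%:E <=
     U s' y' + (((t - s') ^+ 2 + dotv (x - y') (x - y')) / (2 * eps))%:E)%E) ->
  normal_cone (epiU T U) (s, y, fine (U s y)) ((t - s) / eps, eps^-1 *: (x - y), - 1).
Proof.
move=> eps0 sT Ufin yr Umin; set n : pt R N := (_, _, -1); set w : pt R N := (s, y, _).
move=> z tz; rewrite leNgt; apply/negP => c0.
set c := dotp z n in c0.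
have nn0 := dotp_ge0 n; have zz0 := dotp_ge0 z.
(* Chosen so that an error [d] of norm below [k * tau] changes the product with [n] by at most
   [tau * c / 2]. *)
pose k := c / (dotp n n + 1).
have k0 : 0 < k by rewrite divr_gt0//; lra.
have kc : k * (dotp n n + 1) = c by rewrite divfK// gt_eqF//; lra.
have kk0 : 0 <= k ^+ 2 by rewrite sqr_ge0.
(* Below [d1] the quadratic term is too small for the inequality; below [d2] the point of the
   epigraph stays in the ball of radius [r], where minimality is known. *)
pose d1 := c * eps / (4 * (dotp z z + k ^+ 2 + 1)).
pose d2 := (r - `|y|) / (`|z.1.2| + k + 1).
have d10 : 0 < d1 by rewrite divr_gt0// mulr_gt0//; lra.
have d20 : 0 < d2 by rewrite divr_gt0//; [lra|have := normr_ge0 z.1.2; lra].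
have [|tau [/andP[tau0]]] := tz k k0 (Num.min d1 d2); first by rewrite lt_min d10.
rewrite lt_min => /andP[taud1 taud2].
move=> /ereal_inf_lt[_ [e eE <-]]; rewrite lte_fin => dk.
pose d := psub (paddscale w tau z) e.
have es : e.1.1 = s + (tau * z.1.1 - d.1.1) by rewrite /d/psub/paddscale/=; ring.
have ey : e.1.2 = y + (tau *: z.1.2 - d.1.2).
  by rewrite /d/psub/paddscale/=; apply/rowP => i; rewrite !mxE; ring.
have eu : e.2 = fine (U s y) + (tau * z.2 - d.2) by rewrite /d/psub/paddscale/=; ring.
have dk' : pnorm d < k * tau by exact: dk.
have dd : dotp d d <= (k * tau) ^+ 2.
  rewrite -[leLHS]sqr_sqrtr ?dotp_ge0// ler_sqr ?nnegrE ?sqrtr_ge0//; first exact: ltW.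
  by rewrite mulr_ge0// ltW.
clearbody d.
pose tz' : pt R N := (tau * z.1.1, tau *: z.1.2, tau * z.2).
pose q : pt R N := (tau * z.1.1 - d.1.1, tau *: z.1.2 - d.1.2, tau * z.2 - d.2).
have qE : q = paddscale tz' (-1) d by rewrite /q /paddscale /= scaleN1r !mulN1r.
have eyr : `|e.1.2| <= r.
  have h1 : `|d.1.2| <= k * tau by exact: le_trans (normv_le_pnorm _) (ltW dk').
  have h2 : tau * (`|z.1.2| + k + 1) < r - `|y|.
    by rewrite -ltr_pdivlMr//; have := normr_ge0 z.1.2; lra.
  rewrite ey; apply: le_trans (ler_normD _ _) _.
  apply: le_trans (lerD (lexx _) (ler_normB _ _)) _.
  rewrite normrZ gtr0_norm//.
  by move: h1 h2; rewrite !mulrDr mulr1; lra.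
move: eE; rewrite /epiU /= /Uext; case: ifPn => // e1T Ue.
have := le_trans (Umin _ _ e1T eyr) (leeD2r _ Ue).
rewrite -[U s y]fineK// -!EFinD lee_fin => h.
have {h} h : dotp n q <= dotp q q / (2 * eps).
  move: h; rewrite es ey eu.
  set g := tau *: z.1.2 - d.1.2; set qs := _ - d.1.1; set qu := tau * z.2 - d.2.
  rewrite (_ : x - (y + g) = (x - y) - g); last by rewrite opprD addrA.
  rewrite (dotvBB (x - y) g) (dotpC n) /n /dotp /= -/g -/qs -/qu dotvZr (dotvC g (x - y)).
  set A := dotv (x - y) (x - y); set B := dotv (x - y) g; set D := dotv g g.
  rewrite invfM; set i := eps^-1 => h.
  (* The penalty ignores the vertical coordinate; adding its square completes [dotp q q]. *)
  have : 0 <= qu ^+ 2 * i by rewrite mulr_ge0 ?sqr_ge0// invr_ge0 ltW.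
  by move: h; rewrite !expr2; lra.
have nq : dotp n q = tau * c - dotp d n.
  by rewrite (dotpC n) qE dotp_paddscalel mulN1r /c /dotp /= dotvZl; ring.
have nd : 2 * dotp d n <= tau * c.
  rewrite -kc mulrA (mulrC tau) -(ler_pM2l (mulr_gt0 k0 tau0)).
  have := dotp_ge0 (paddscale d (- (k * tau)) n); rewrite dotp_paddscale2 sqrrN.
  move: dd; rewrite !expr2; lra.
have qq : dotp q q <= 2 * (tau ^+ 2 * (dotp z z + k ^+ 2)).
  have tztz : dotp tz' tz' = tau ^+ 2 * dotp z z.
    by rewrite /dotp /= dotvZl dotvZr; ring.
  have := dotp_ge0 (paddscale tz' 1 d); rewrite qE !dotp_paddscale2 tztz.
  move: dd; rewrite exprMn !expr2; lra.
have : tau * c / 2 <= tau * (tau * (dotp z z + k ^+ 2)) / eps.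
  have : dotp q q / (2 * eps) <= 2 * (tau ^+ 2 * (dotp z z + k ^+ 2)) / (2 * eps).
    by rewrite ler_pM2r// invr_gt0 mulr_gt0.
  have -> : 2 * (tau ^+ 2 * (dotp z z + k ^+ 2)) / (2 * eps) =
      tau * (tau * (dotp z z + k ^+ 2)) / eps by field; rewrite gt_eqF.
  by lra.
rewrite -!mulrA ler_pM2l// mulrA ler_pdivlMr// => {}h.
have : tau * (4 * (dotp z z + k ^+ 2 + 1)) < c * eps.
  by rewrite -ltr_pdivlMr// mulr_gt0//; lra.
have : 0 < c * eps by exact: mulr_gt0.
move: h; set X := dotp z z; set Y := k ^+ 2.
by lra.
Qed.
End proximal_normals.

Definition normal_condition {R : realType} {N : nat} (T : R)
    (L : R -> 'rV[R]_N -> 'rV[R]_N -> \bar R) (U : R -> 'rV[R]_N -> \bar R) : Prop :=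
  forall (t : R) (x : 'rV[R]_N), 0 <= t < T -> U t x \is a fin_num ->
  forall (nt : R) (nx : 'rV[R]_N) (nu : R),
    normal_cone (epiU T U) (t, x, fine (U t x)) (nt, nx, nu) ->
    exists (tk : nat -> R) (xk : nat -> 'rV[R]_N) (ak : nat -> R) (vk : nat -> 'rV[R]_N),
      [/\ forall k, 0 <= tk k <= T,
          (tk @ \oo --> t) /\ (xk @ \oo --> x), (ak @ \oo --> 0),
          forall k, L (tk k) (xk k) (vk k) \is a fin_num
        & forall k, nt + dotv (vk k) nx - nu * fine (L (tk k) (xk k) (vk k)) <= ak k].

(** If no such [v] exists, [v |-> - <v, px> - pt] is a strict affine minorant of [L] at [(s, y)]. It
    persists at [(tk, xk)] with a margin, against the normal condition once [ak] is below that
    margin. *)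
Lemma normal_velocity {R : realType} {N : nat} (T : R)
    (L : R -> 'rV[R]_N -> 'rV[R]_N -> \bar R) (U : R -> 'rV[R]_N -> \bar R)
    (s pt : R) (y px : 'rV[R]_N) :
  L1 T L -> L4 T L -> normal_condition T L U -> 0 <= s < T -> U s y \is a fin_num ->
  normal_cone (epiU T U) (s, y, fine (U s y)) (pt, px, -1) ->
  exists v, (L s y v <= (- pt - dotv v px)%:E)%E.
Proof.
move=> hL1 hL4 nc /andP[s0 sT] Ufin ncone; apply: contrapT => nov.
have sT' : 0 <= s <= T by rewrite s0 ltW.
have Lbig v : ((dotv v (- px) - pt)%:E < L s y v)%E.
  rewrite ltNge; apply/negP => h; apply: nov; exists v; apply: le_trans h _.
  by rewrite dotvNr lee_fin; lra.
have [k' [r [k'pt r0 stab]]] := affine_minorant_stable hL1 hL4 sT' Lbig.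
have [|tk [xk [ak [vk [tkT [tks xky] ak0 Lfin ineq]]]]] := nc s y _ Ufin _ _ _ ncone.
  by rewrite s0.
have [K _ HK] : \forall k \near \oo, [/\ `|tk k - s| < r, `|xk k - y| < r & ak k < pt - k'].
  near=> k; split.
  - by rewrite distrC; near: k; exact: cvgr_dist_lt.
  - by rewrite distrC; near: k; exact: cvgr_dist_lt.
  - by near: k; apply: (cvgr_lt _ ak0); lra.
have [h1 h2 h3] := HK K (leqnn K).
have := stab _ _ (vk K) (tkT K) h1 h2; rewrite -[L _ _ _]fineK// lte_fin dotvNr.
by have := ineq K; lra.
Unshelve. all: by end_near. Qed.

(** * Infimal convolution of [U] with a quadratic *)

Definition quad {R : realType} {N : nat} (eps t : R) (x : 'rV[R]_N) (s : R) (y : 'rV[R]_N) : R :=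
  ((t - s) ^+ 2 + dotv (x - y) (x - y)) / (2 * eps).

Section infimal_convolution.
Context {R : realType} {N : nat} (T : R) (U : R -> 'rV[R]_N -> \bar R).
Hypotheses (T0 : 0 <= T) (Uprop : U_proper T U) (Ulsc : U_lsc T U).

Let lscU (s : R) (y : 'rV[R]_N) (a : R) : 0 <= s <= T -> (a%:E < U s y)%E ->
  \forall q \near ((s, y) : R * 'rV[R]_N), 0 <= q.1 <= T -> (a%:E < U q.1 q.2)%E.
Proof.
move=> sT aU; have [|V Vsy Va] := @Ulsc (s, y) a; first by rewrite /= /Uext sT.
by apply: filterS Vsy => q /Va; rewrite /Uext; case: ifP.
Qed.

Lemma U_lsc_within (s : R) (y : 'rV[R]_N) (a : R) : 0 <= s <= T -> (a%:E < U s y)%E ->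
  exists2 d : R, 0 < d & forall s' y', 0 <= s' <= T -> `|s' - s| < d -> `|y' - y| < d ->
    (a%:E < U s' y')%E.
Proof.
move=> sT /(lscU sT)/nbhs_ballP[d /= d0 Hd]; exists d => // s' y' s'T ss yy.
by apply: (Hd (s', y')) => //; split; rewrite -ball_normE /= distrC.
Qed.

(** [U] may be unbounded below at infinity, so the minimum is taken over a ball only. *)
Lemma quad_min (eps t r : R) (x : 'rV[R]_N) : 0 <= r ->
  exists s y, [/\ 0 <= s <= T, `|y| <= r &
    forall s' y', 0 <= s' <= T -> `|y'| <= r ->
    (U s y + (quad eps t x s y)%:E <= U s' y' + (quad eps t x s' y')%:E)%E].
Proof.
move=> r0; pose K : set (R * 'rV[R]_N) := `[0, T]%classic `*` [set y | `|y| <= r].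
have cK : compact K by apply: compact_setX; [exact: segment_compact|exact: compact_normv_ball].
have K0 : K !=set0 by exists (0, 0); rewrite /K /= in_itv /= lexx T0 normr0.
have [|[s y] Ksy smin] := @compact_lsc_min R _ K
    (fun q : R * 'rV[R]_N => U q.1 q.2 + (quad eps t x q.1 q.2)%:E)%E cK K0.
  move=> [s y] [/= sT _] a.
  apply: (@lsc_add_continuous R _ K (fun q : R * 'rV[R]_N => U q.1 q.2)
    (fun q : R * 'rV[R]_N => quad eps t x q.1 q.2) (s, y)).
    move=> b bU; move: sT; rewrite in_itv/= => sT.
    have := lscU sT bU; apply: filterS => q h [].
    by rewrite /= in_itv/= => /h.
  have c1 : q.1 @[q --> (s, y)] --> s by exact: cvg_fst.
  have c2 : q.2 @[q --> (s, y)] --> y by exact: cvg_snd.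
  apply: cvgM; last exact: cvg_cst.
  apply: cvgD.
    by apply: (cvgM (cvgB (cvg_cst t) c1) (cvgB (cvg_cst t) c1)).
  by apply: cvg_dotv; apply: (cvgB (cvg_cst x) c2).
have [sT yr] := Ksy; move: sT; rewrite /= in_itv/= => sT.
exists s, y; split=> // s' y' s'T y'r; apply: (smin (s', y')).
by rewrite /K /= in_itv.
Qed.

Lemma U_lbound (r : R) : 0 <= r -> exists2 m : R, 0 <= m &
  forall t x, 0 <= t <= T -> `|x| <= r -> ((- m)%:E < U t x)%E.
Proof.
move=> r0; pose K : set (R * 'rV[R]_N) := `[0, T]%classic `*` [set y | `|y| <= r].
have cK : compact K by apply: compact_setX; [exact: segment_compact|exact: compact_normv_ball].
have K0 : K !=set0 by exists (0, 0); rewrite /K /= in_itv /= lexx T0 normr0.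
have [|[s y] Ksy smin] := @compact_lsc_min R _ K (fun q : R * 'rV[R]_N => U q.1 q.2)%E cK K0.
  move=> [s y] [/= sT _] b bU; move: sT; rewrite in_itv/= => sT.
  have := lscU sT bU; apply: filterS => q h [].
  by rewrite /= in_itv/= => /h.
have [sT yr] := Ksy; move: sT; rewrite /= in_itv/= => sT.
have [m mU] : exists m : R, (m%:E < U s y)%E.
  have := Uprop.1 s y; rewrite /Uext sT; case: (U s y) => [l| |//] _.
    by exists (l - 1); rewrite lte_fin; lra.
  by exists 0; rewrite ltry.
exists `|m| => // t x tT xr.
apply: (@le_lt_trans _ _ m%:E); first by rewrite lee_fin lerNl ler_normr lexx orbT.
apply: (lt_le_trans mU); apply: (smin (t, x)).
by rewrite /K /= in_itv.
Qed.

End infimal_convolution.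

(* The point [(s, y)] witnesses that the infimal convolution of [U] with [quad eps],
   taken over the ball of radius [r], is at most [b] at [(t, x)]. *)
Definition touches {R : realType} {N : nat} (U : R -> 'rV[R]_N -> \bar R)
    (eps r t : R) (x : 'rV[R]_N) (b s : R) (y : 'rV[R]_N) : Prop :=
  `|y| <= r /\ exists2 c : R, U s y = c%:E & c + quad eps t x s y <= b.

(* The velocity [v] is chosen at the touching point [(s, y)]: at the current point
   [w = (t, x, u)] itself nothing is known about [U] or about the domain of [L]. *)
Definition euler_move {R : realType} {N : nat} (T : R)
    (L : R -> 'rV[R]_N -> 'rV[R]_N -> \bar R) (U : R -> 'rV[R]_N -> \bar R)
    (C m eps h r b : R) (w w' : pt R N) : Prop :=
  exists (s : R) (y v : 'rV[R]_N) (l : R),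
    [/\ 0 <= s < T /\ `|w.1.2| <= r, touches U eps (r + 1) w.1.1 w.1.2 b s y, L s y v = l%:E,
        `|v| <= C /\ - m < l & w' = (w.1.1 + h, w.1.2 + h *: v, w.2 - h * l)].

(* [X] is frozen once it leaves the ball of radius [r], hence the alternatives [r < `|X t|];
   [d] bounds the mesh and the distance from [(t, X t)] to its touching point. *)
Definition approx_trajectory {R : realType} {N : nat} (T : R)
    (L : R -> 'rV[R]_N -> 'rV[R]_N -> \bar R) (U : R -> 'rV[R]_N -> \bar R)
    (r C m t0 : R) (x0 : 'rV[R]_N) (u0 d : R) (X : R -> 'rV[R]_N) (Y : R -> R) : Prop :=
  [/\ [/\ X t0 = x0, Y t0 = u0, forall t, t <= t0 -> X t = X t0 /\ Y t = Y t0,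
        forall t, T <= t -> X t = X T /\ Y t = Y T &
        forall s t, s <= t -> r < `|X s| -> X t = X s],
      forall s t, s <= t -> `|X t - X s| <= C * (t - s + d) /\ Y t - Y s <= m * (t - s + d),
      forall t, - (m + 1) <= Y t,
      forall t, t0 <= t <= T -> r < `|X t| \/
        exists s y, [/\ 0 <= s <= T, `|s - t| <= d, `|y - X t| <= d & (U s y <= (Y t + d)%:E)%E] &
      forall a b p k, t0 <= a -> a <= b -> b + d < T -> r < `|X b| \/
        ((forall s y v l, 0 <= s <= T -> `|s - b| <= b - a + d ->
            `|y - X b| <= C * (b - a + d) + d -> L s y v = l%:E -> dotv v p - l <= k) ->
         dotv (X b - X a) p + (Y b - Y a) <= k * (b - a) + `|k| * d)].

(** * The Euler scheme and its error estimates *)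

Section euler_step.
Context {R : realType} {N : nat} (T : R) (L : R -> 'rV[R]_N -> 'rV[R]_N -> \bar R)
  (U : R -> 'rV[R]_N -> \bar R).
Hypotheses (T0 : 0 <= T) (hL1 : L1 T L) (hL4 : L4 T L) (Ulsc : U_lsc T U) (nc : normal_condition T L U).
Variables (r C m : R).
Hypotheses (r0 : 0 <= r) (C0 : 0 <= C) (m0 : 0 <= m).
Hypothesis hC : forall t x v, 0 <= t <= T -> `|x| <= r + 1 -> C < `|v| -> L t x v = +oo%E.
Hypothesis hmL : forall t x v, 0 <= t <= T -> `|x| <= r + 1 -> ((- m)%:E < L t x v)%E.
Hypothesis hmU : forall t x, 0 <= t <= T -> `|x| <= r + 1 -> ((- m)%:E < U t x)%E.

(** Since [U > - m] on the ball, at most [b + m] is left for the penalty. *)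
Lemma touches_close (eps t b s : R) (x y : 'rV[R]_N) : 0 < eps -> 0 <= s <= T ->
  touches U eps (r + 1) t x b s y ->
  (t - s) ^+ 2 <= 2 * eps * (b + m) /\ `|x - y| ^+ 2 <= 2 * eps * (b + m).
Proof.
move=> eps0 sT [yr [c Uc cb]].
have := hmU sT yr; rewrite Uc lte_fin => mc.
have : ((t - s) ^+ 2 + dotv (x - y) (x - y)) <= 2 * eps * (b + m).
  rewrite mulrC -ler_pdivrMr ?mulr_gt0// -/(quad eps t x s y).
  by lra.
have := sqr_ge0 (t - s); have := dotv_ge0 (x - y); have := normv_sqr_le_dotv (x - y).
by split; lra.
Qed.

(** A minimiser [(s, y)] at the old point also serves as touching point for the new one. To first
    order the penalty changes by at most [- h * l], which is the change of [u]; the second order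
    term is the added error. The scheme stops when [s = T], where the normal condition is silent. *)
Lemma euler_stepP (eps h b : R) (w : pt R N) : 0 < eps -> 0 < h ->
  2 * eps * (b + m) < 1 ->
  (exists s y, 0 <= s <= T /\ touches U eps (r + 1) w.1.1 w.1.2 b s y) ->
  [\/ r < `|w.1.2|, exists y, touches U eps (r + 1) w.1.1 w.1.2 b T y |
      exists w', [/\ euler_move T L U C m eps h r b w w' &
        exists s y, 0 <= s <= T /\ touches U eps (r + 1) w'.1.1 w'.1.2
          (b + (w'.2 - w.2) + h ^+ 2 * (1 + N%:R * C ^+ 2) / (2 * eps)) s y]].
Proof.
case: w => -[t x] u /= eps0 h0 bm [s1 [y1 [s1T [y1r [c1 U1 c1b]]]]].
have [?|xr] := ltP r `|x|; first by constructor 1.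
have [s [y [sT yr smin]]] := @quad_min R N T U T0 Ulsc eps t (r + 1) x (addr_ge0 r0 ler01).
have := smin _ _ s1T y1r; rewrite U1 -EFinD => Vb.
have [c Uc] : exists c : R, U s y = c%:E.
  have := hmU sT yr; move: Vb; case: (U s y) => [c| |//]; first by exists c.
  by rewrite addye.
have cb : c + quad eps t x s y <= b by move: Vb; rewrite Uc -EFinD lee_fin; lra.
have tch : touches U eps (r + 1) t x b s y by split=> //; exists c.
have [sT'|sT'] := eqVneq s T.
  by constructor 2; exists y; rewrite -sT'.
have [_ xy] := touches_close eps0 sT tch.
(* Hence [|y| < r + 1]: the minimiser is inside the ball, as [proximal_normal] requires. *)
have xy1 : `|x - y| < 1.
  have : `|x - y| ^+ 2 < 1 by exact: le_lt_trans xy bm.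
  by rewrite expr_lt1.
have yr1 : `|y| < r + 1.
  by have := ler_normB x (x - y); rewrite opprB addrC subrK; lra.
have sT2 : 0 <= s < T by move: sT => /andP[-> ?]; rewrite lt_neqAle sT'.
have Ufin : U s y \is a fin_num by rewrite Uc.
have nrm := proximal_normal eps0 sT Ufin yr1 smin.
have [v Lv] := normal_velocity hL1 hL4 nc sT2 Ufin nrm.
have [l Ll] : exists l : R, L s y v = l%:E.
  have := hmL v sT yr; move: Lv; case: (L s y v) => [l| |//]; first by exists l.
  by rewrite leye_eq.
have ml : - m < l by rewrite -lte_fin -Ll hmL.
have vC : `|v| <= C.
  by rewrite leNgt; apply/negP => Cv; have := hC sT yr Cv; rewrite Ll.
move: Lv; rewrite Ll lee_fin dotvZr => Lv.
constructor 3; exists (t + h, x + h *: v, u - h * l); split.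
  by exists s, y, v, l.
exists s, y; split=> //=; split=> //; exists c => //.
have vv : dotv v v <= N%:R * C ^+ 2.
  apply: le_trans (ler_norm _) _; apply: le_trans (dotv_le_norm _ _) _.
  by rewrite ler_wpM2l// expr2 ler_pM.
have -> : quad eps (t + h) (x + h *: v) s y = quad eps t x s y +
    h * ((t - s) / eps + eps^-1 * dotv v (x - y)) + h ^+ 2 * (1 + dotv v v) / (2 * eps).
  rewrite /quad.
  have -> : x + h *: v - y = (x - y) - (- h) *: v by rewrite scaleNr opprK addrAC.
  rewrite (dotvBB (x - y) (- h *: v)) dotvZl !dotvZr (dotvC (x - y) v).
  by field; rewrite gt_eqF.
have : h ^+ 2 * (1 + dotv v v) / (2 * eps) <= h ^+ 2 * (1 + N%:R * C ^+ 2) / (2 * eps).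
  by rewrite ler_wpM2r ?invr_ge0 ?mulr_ge0 ?(ltW eps0)// ler_wpM2l ?sqr_ge0// lerD2l.
have : h * ((t - s) / eps + eps^-1 * dotv v (x - y)) <= h * (- l) by rewrite ler_wpM2l ?(ltW h0)//; lra.
by lra.
Qed.

(** Induction on the number of allowed steps; [j] counts the moves made before stopping. Each move
    adds an error [k] to the touching level, and [B] bounds all levels, so that [euler_stepP] stays
    applicable. *)
Lemma euler_chain (eps h t0 u0 B k : R) (x0 : 'rV[R]_N) (M : nat) :
  0 < eps -> 0 < h -> 0 <= t0 <= T -> `|x0| <= r + 1 -> U t0 x0 = u0%:E ->
  k = h ^+ 2 * (1 + N%:R * C ^+ 2) / (2 * eps) ->
  u0 + M%:R * (h * m + k) <= B -> 2 * eps * (B + m) < 1 ->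
  exists (w : nat -> pt R N) (j : nat),
  [/\ w 0%N = (t0, x0, u0) /\ (j <= M)%N,
      forall i, (i < j)%N ->
        euler_move T L U C m eps h r ((w i).2 + i%:R * k) (w i) (w i.+1),
      forall i, (j <= i)%N -> w i = w j,
      forall i, (i <= j)%N -> (w i).2 <= u0 + i%:R * (h * m) /\
        exists s y, 0 <= s <= T /\
          touches U eps (r + 1) (w i).1.1 (w i).1.2 ((w i).2 + i%:R * k) s y &
      (j < M)%N -> r < `|(w j).1.2| \/
        exists y, touches U eps (r + 1) (w j).1.1 (w j).1.2 ((w j).2 + j%:R * k) T y].
Proof.
move=> eps0 h0 t0T x0r U0 kE.
have k0 : 0 <= k.
  have c10 : 0 <= 1 + N%:R * C ^+ 2 by rewrite addr_ge0// mulr_ge0// sqr_ge0.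
  by rewrite kE divr_ge0//; [rewrite mulr_ge0// sqr_ge0|rewrite mulr_ge0// ltW].
have hm0 : 0 <= h * m by rewrite mulr_ge0// ltW.
elim: M => [|M IH] uB Bm.
  exists (fun=> (t0, x0, u0)), 0%N; split=> //.
  (* The starting point touches at itself with zero penalty. *)
  move=> i; rewrite leqn0 => /eqP ->; rewrite !mul0r !addr0; split=> //.
  exists t0, x0; split=> //=; split=> //; exists u0 => //.
  by rewrite /quad !subrr expr0n /= dotv0l addr0 mul0r addr0.
have [|//|w [j [[w0 jM] mv cst inv stuck]]] := IH.
  by apply: le_trans uB; rewrite lerD2l ler_wpM2r ?addr_ge0// ler_nat.
move: jM; rewrite leq_eqVlt => /orP[/eqP jM|jM]; last first.
  exists w, j; split=> //; first by split=> //; rewrite leqW// ltnW.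
  by move=> _; exact: stuck.
have [uM tM] := inv j (leqnn j).
have bB : (w j).2 + j%:R * k <= B.
  apply: le_trans uB; apply: (@le_trans _ _ (u0 + j%:R * (h * m + k))).
    by rewrite mulrDr; lra.
  by rewrite lerD2l ler_wpM2r ?addr_ge0// ler_nat jM.
have bm : 2 * eps * ((w j).2 + j%:R * k + m) < 1.
  by apply: le_lt_trans Bm; rewrite ler_wpM2l ?mulr_ge0 ?(ltW eps0)//; lra.
have [rw|sT|[w' [mv' tch']]] := euler_stepP eps0 h0 bm tM.
- exists w, j; split=> //; first by split=> //; rewrite jM leqnSn.
  by move=> _; left.
- exists w, j; split=> //; first by split=> //; rewrite jM leqnSn.
  by move=> _; right.
exists (fun i => if (i <= j)%N then w i else w'), j.+1; split.
- by rewrite /= w0 jM.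
- move=> i; rewrite [(i < _)%N]ltnS => ji; move: (ji); rewrite {1}leq_eqVlt => /orP[/eqP ->|ij].
    by rewrite leqnn ltnn.
  by rewrite (ltnW ij) ij; exact: mv.
- by move=> i ji; rewrite ltnn leqNgt ji.
- move=> i; rewrite leq_eqVlt => /orP[/eqP ->|]; last first.
    by rewrite ltnS => ij; rewrite ij; exact: inv.
  rewrite ltnn; split.
    have [s [y [v [l [_ _ _ [_ ml] ->]]]]] := mv'.
    have : h * (- l) <= h * m by rewrite ler_wpM2l ?(ltW h0)//; lra.
    by rewrite -natr1 mulrDl mul1r /=; lra.
  have [s [y [sT tch]]] := tch'; exists s, y; split=> //.
  by move: tch; rewrite -kE -natr1 mulrDl mul1r (_ : _ + k = w'.2 + (j%:R * k + k))//; ring.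
- by rewrite ltnS jM ltnn.
Qed.

Lemma sqr_le_half (a d : R) : 0 <= d -> a ^+ 2 <= d ^+ 2 / 8 -> `|a| <= d / 2.
Proof.
move=> d0 h; have d20 : 0 <= d / 2 by rewrite divr_ge0.
rewrite -(@ler_sqr R) ?nnegrE ?normr_ge0// real_normK ?num_real//.
by apply: le_trans h _; have := sqr_ge0 d; rewrite !expr2; lra.
Qed.

Lemma step_index (t0 h : R) : 0 < h -> t0 < T -> exists idx : R -> nat,
  [/\ (forall t, t <= t0 -> idx t = 0%N) /\ (forall t, T <= t -> idx t = idx T),
      forall s t, s <= t -> (idx s <= idx t)%N,
      forall s t, s <= t -> h * (idx t)%:R - h * (idx s)%:R <= t - s + h &
      forall t, t0 <= t -> t <= T -> h * (idx t)%:R <= t - t0 < h * (idx t)%:R + h].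
Proof.
move=> h0 t0T.
(* [Num.truncn] is 0 on negative numbers, which freezes the index before [t0]; the minimum with [T]
   freezes it after [T]. *)
pose idx (t : R) := Num.truncn ((Num.min t T - t0) / h).
have idxP t : t0 <= t -> h * (idx t)%:R <= Num.min t T - t0 < h * (idx t)%:R + h.
  move=> tt0; have a0 : 0 <= (Num.min t T - t0) / h.
    by rewrite divr_ge0 ?(ltW h0)// subr_ge0 le_min tt0 ltW.
  have /andP[h1 h2] := truncn_itv a0; apply/andP; split.
    by rewrite mulrC -ler_pdivlMr.
  by move: h2; rewrite ltr_pdivrMr// -natr1 mulrDl mul1r mulrC.
have idx0 t : t <= t0 -> idx t = 0%N.
  move=> tt0; have [e|e] := eqVneq t t0.
    by rewrite e /idx min_l ?(ltW t0T)// subrr mul0r truncn0.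
  have tt : t < t0 by rewrite lt_neqAle e.
  apply/truncn0Pn; rewrite -ltNge ltr_pdivrMr//.
  have : Num.min t T <= t by rewrite ge_min lexx.
  by lra.
have idxT t : T <= t -> idx t = idx T by move=> Tt; rewrite /idx min_r// minxx.
have idx_mono s t : s <= t -> (idx s <= idx t)%N.
  move=> st; apply: le_truncn; rewrite ler_pM2r ?invr_gt0// lerD2r.
  by rewrite le_min !ge_min st lexx orbT.
have idx_lip s t : s <= t -> h * (idx t)%:R - h * (idx s)%:R <= t - s + h.
  move=> st; have mt : Num.min t T <= t by rewrite ge_min lexx.
  have [t0s|/ltW st0] := leP t0 s; last first.
    rewrite (idx0 _ st0) mulr0 subr0.
    have [t0t|/ltW tt0] := leP t0 t; last by rewrite (idx0 _ tt0) mulr0; lra.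
    by have /andP[] := idxP _ t0t; lra.
  have /andP[h1 _] := idxP _ (le_trans t0s st); have /andP[_ h2] := idxP _ t0s.
  have [sT|Ts] := leP s T; first by move: h2; rewrite (min_l sT); lra.
  by rewrite (idxT _ (ltW Ts)) (idxT t) ?(le_trans (ltW Ts) st)//; lra.
have idx_le t : t0 <= t -> t <= T -> h * (idx t)%:R <= t - t0 < h * (idx t)%:R + h.
  by move=> h1 h2; have := idxP t h1; rewrite min_l.
by exists idx.
Qed.

(** The interpolants are constant on each grid step, so an estimate between grid times costs at most
    one step [h], absorbed by the slack [d]. *)
Lemma euler_interpolation (eps h d B k t0 u0 : R) (x0 : 'rV[R]_N) (idx : R -> nat)
    (w : nat -> pt R N) (j : nat) : let M := idx T in
  0 < eps -> 0 < h -> 0 < d <= 1 -> 0 <= k -> 2 * h <= d -> t0 < T ->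
  (forall t, t <= t0 -> idx t = 0%N) -> (forall t, T <= t -> idx t = idx T) ->
  (forall s t, s <= t -> (idx s <= idx t)%N) ->
  (forall s t, s <= t -> h * (idx t)%:R - h * (idx s)%:R <= t - s + h) ->
  (forall t, t0 <= t -> t <= T -> h * (idx t)%:R <= t - t0 < h * (idx t)%:R + h) ->
  (forall i, (i <= M)%N -> i%:R * k <= d ^+ 2 / 2) ->
  u0 + M%:R * (h * m + k) <= B -> 2 * eps * (B + m) <= d ^+ 2 / 8 ->
  w 0%N = (t0, x0, u0) -> (j <= M)%N ->
  (forall i, (i < j)%N ->
     euler_move T L U C m eps h r ((w i).2 + i%:R * k) (w i) (w i.+1)) ->
  (forall i, (j <= i)%N -> w i = w j) ->
  (forall i, (i <= j)%N -> (w i).2 <= u0 + i%:R * (h * m) /\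
     exists s y, 0 <= s <= T /\
       touches U eps (r + 1) (w i).1.1 (w i).1.2 ((w i).2 + i%:R * k) s y) ->
  ((j < M)%N -> r < `|(w j).1.2| \/
     exists y, touches U eps (r + 1) (w j).1.1 (w j).1.2 ((w j).2 + j%:R * k) T y) ->
  approx_trajectory T L U r C m t0 x0 u0 d (fun t => (w (idx t)).1.2) (fun t => (w (idx t)).2).
Proof.
move=> M eps0 h0 /andP[d0 d1] k0 hd t0T idx0 idxT idx_mono idx_lip idx_le ik BM epsB
  w0 jM mv cst inv stuck.
have dd : d ^+ 2 <= d by rewrite expr2 ler_piMr// ltW.
have idxM t : (idx t <= M)%N.
  have [tT|/ltW Tt] := leP t T; first exact: idx_mono.
  by rewrite (idxT t Tt).
pose X t := (w (idx t)).1.2; pose Y t := (w (idx t)).2.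
have ti i : (i <= j)%N -> (w i).1.1 = t0 + h * i%:R.
  elim: i => [_|i IH ij]; first by rewrite w0 mulr0 addr0.
  have [s [y [v [l [_ _ _ _ ->]]]]] := mv i ij.
  by rewrite /= IH ?(ltnW ij)// -natr1; ring.
have step i : `|(w i.+1).1.2 - (w i).1.2| <= C * h /\ (w i.+1).2 - (w i).2 <= m * h.
  have [ij|ji] := ltnP i j; last first.
    rewrite (cst i ji) (cst i.+1 (leqW ji)) !subrr normr0.
    by split; rewrite mulr_ge0// ltW.
  have [s [y [v [l [_ _ _ [vC ml] ->]]]]] := mv i ij; split=> /=.
    by rewrite addrC addKr normrZ gtr0_norm// mulrC ler_wpM2r// ltW.
  by rewrite addrC addKr -mulrN mulrC ler_wpM2r ?(ltW h0)//; lra.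
have lip i n : `|(w (i + n)%N).1.2 - (w i).1.2| <= C * (h * n%:R) /\
    (w (i + n)%N).2 - (w i).2 <= m * (h * n%:R).
  elim: n => [|n [IH1 IH2]]; first by rewrite addn0 !subrr normr0 !mulr0.
  have [h1 h2] := step (i + n)%N; rewrite addnS -natr1; split; last by lra.
  rewrite -(subrKA (w (i + n)%N).1.2); apply: le_trans (ler_normD _ _) _.
  by apply: le_trans (lerD h1 IH1) _; rewrite le_eqVlt; apply/orP; left; apply/eqP; ring.
have lipXY s t : s <= t -> `|X t - X s| <= C * (t - s + h) /\ Y t - Y s <= m * (t - s + h).
  move=> st; have st' := idx_mono _ _ st.
  have [] := lip (idx s) (idx t - idx s)%N; rewrite subnKC// natrB// mulrBr => h1 h2.
  have h3 := idx_lip _ _ st; split.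
    by apply: le_trans h1 _; rewrite ler_wpM2l.
  by apply: le_trans h2 _; rewrite ler_wpM2l.
have bB i : (i <= j)%N -> (w i).2 + i%:R * k <= B.
  move=> ij; have [ui _] := inv i ij; apply: le_trans BM.
  apply: (@le_trans _ _ (u0 + i%:R * (h * m + k))); first by rewrite mulrDr; lra.
  have hmk : 0 <= h * m + k by rewrite addr_ge0// mulr_ge0// ltW.
  by rewrite lerD2l (ler_wpM2r hmk)// ler_nat (leq_trans ij).
(* Half of [d] is spent on the touching point; the other half is kept for the mesh. *)
have close i s y : (i <= j)%N -> 0 <= s <= T ->
    touches U eps (r + 1) (w i).1.1 (w i).1.2 ((w i).2 + i%:R * k) s y ->
    [/\ `|t0 + h * i%:R - s| <= d / 2, `|(w i).1.2 - y| <= d / 2 &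
      (U s y <= ((w i).2 + d)%:E)%E].
  move=> ij sT tch; have [] := touches_close eps0 sT tch; rewrite ti// => h1 h2.
  have h3 : 2 * eps * ((w i).2 + i%:R * k + m) <= d ^+ 2 / 8.
    by apply: le_trans epsB; rewrite ler_wpM2l ?mulr_ge0 ?(ltW eps0)// lerD2r bB.
  split; first by apply: sqr_le_half; rewrite ?(ltW d0)//; exact: le_trans h1 h3.
    by rewrite -[leLHS]normr_id; apply: sqr_le_half; rewrite ?(ltW d0)//; exact: le_trans h2 h3.
  have [_ [c -> cb]] := tch; rewrite lee_fin.
  have : 0 <= quad eps (w i).1.1 (w i).1.2 s y.
    by rewrite divr_ge0 ?addr_ge0 ?sqr_ge0 ?dotv_ge0// mulr_ge0// ltW.
  by have := ik i (leq_trans ij jM); lra.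
have TT : 0 <= T <= T by rewrite T0 lexx.
rewrite -/X -/Y; split.
- split; rewrite /X /Y ?(idx0 t0)// ?w0//.
    by move=> t tt0; rewrite (idx0 t tt0) w0.
    by move=> t Tt; rewrite (idxT t).
  move=> s t st rX; have [ij|ji] := ltnP (idx s) j.
    have [s' [y [v [l [[_ xr] _ _ _ _]]]]] := mv _ ij.
    by move: rX; rewrite ltNge xr.
  by rewrite (cst _ ji) (cst _ (leq_trans ji (idx_mono _ _ st))).
- move=> s t st; have [h1 h2] := lipXY s t st; split.
    by apply: le_trans h1 _; rewrite ler_wpM2l// lerD2l; lra.
  by apply: le_trans h2 _; rewrite ler_wpM2l// lerD2l; lra.
- have Yj i : (i <= j)%N -> - (m + 1) <= (w i).2.
    move=> ij; have [_ [s [y [sT tch]]]] := inv i ij.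
    have [_ _] := close i s y ij sT tch; have := hmU sT tch.1.
    by move=> hm /(lt_le_trans hm); rewrite lte_fin; lra.
  move=> t; rewrite /Y; have [ij|/ltnW ji] := leqP (idx t) j; first exact: Yj.
  by rewrite (cst _ ji) Yj.
- move=> t /andP[t0t tT]; have /andP[i1 i2] := idx_le t t0t tT.
  have [ij|ji] := leqP (idx t) j.
    right; have [_ [s [y [sT tch]]]] := inv _ ij.
    have [h1 h2 h3] := close _ s y ij sT tch.
    exists s, y; split=> //; last by apply: le_trans h2 _ || (rewrite distrC; lra).
    by move: h1; rewrite !ler_norml => /andP[? ?]; apply/andP; split; lra.
  have jM' : (j < M)%N by exact: leq_trans ji (idxM t).
  rewrite /X /Y (cst _ (ltnW ji)); have [?|[y tch]] := stuck jM'; [by left|right].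
  have [h1 h2 h3] := close _ T y (leqnn j) TT tch.
  exists T, y; split=> //; last by rewrite distrC; lra.
  have : h * j%:R <= h * (idx t)%:R by rewrite ler_wpM2l ?(ltW h0)// ler_nat ltnW.
  by move: h1; rewrite !ler_norml => /andP[? ?] ?; apply/andP; split; lra.
move=> a b p q t0a ab bT.
have aT : a <= T by lra.
have bT' : b <= T by lra.
have /andP[a1 a2] := idx_le a t0a aT.
have /andP[b1 b2] := idx_le b (le_trans t0a ab) bT'.
(* As [b + d < T], the scheme cannot have stopped before [b] by touching at time [T]; it must have
   left the ball. *)
have [bj|jb] := leqP (idx b) j; last first.
  left; rewrite /X (cst _ (ltnW jb)).
  have [//|[y tch]] := stuck (leq_trans jb (idxM b)).
  have [h1 _ _] := close _ T y (leqnn j) TT tch.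
  have : h * j%:R <= h * (idx b)%:R by rewrite ler_wpM2l ?(ltW h0)// ler_nat ltnW.
  by move: h1; rewrite !ler_norml => /andP[? ?] ?; exfalso; lra.
right=> hyp.
have main n : (idx a + n <= idx b)%N ->
    dotv ((w (idx a + n)%N).1.2 - (w (idx a)).1.2) p + ((w (idx a + n)%N).2 - (w (idx a)).2)
    <= q * (h * n%:R).
  elim: n => [_|n IH]; first by rewrite addn0 !subrr mulr0 mulr0 addr0 dotv0l.
  rewrite addnS => anb; have {}IH := IH (ltnW anb); have ij := leq_trans anb bj.
  have [s [y [v [l [[/andP[s0 sT] _] tch Ll _ wE]]]]] := mv _ ij.
  have sT' : 0 <= s <= T by rewrite s0 ltW.
  have [h1 h2 _] := close _ s y (ltnW ij) sT' tch.
  have ha : h * (idx a)%:R <= h * (idx a + n)%N%:R.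
    by rewrite ler_wpM2l ?(ltW h0)// ler_nat leq_addr.
  have hb : h * (idx a + n)%N%:R <= h * (idx b)%:R.
    by rewrite ler_wpM2l ?(ltW h0)// ler_nat ltnW.
  have vl : dotv v p - l <= q.
    apply: (hyp s y v l sT') => //.
      by move: h1; rewrite !ler_norml => /andP[? ?]; apply/andP; split; lra.
    have [+ _] := lip (idx a + n)%N (idx b - (idx a + n))%N; rewrite subnKC ?(ltnW anb)//.
    rewrite natrB ?(ltnW anb)// mulrBr -/(X b) => h3.
    have h4 : C * (h * (idx b)%:R - h * (idx a + n)%:R) <= C * (b - a + d).
      by rewrite ler_wpM2l//; lra.
    rewrite -(subrKA (w (idx a + n)%N).1.2); apply: le_trans (ler_normD _ _) _.
    by rewrite [`|y - _|]distrC [`|_ - X b|]distrC; lra.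
  have : h * (dotv v p - l) <= h * q by rewrite ler_wpM2l// ltW.
  rewrite wE /= -natr1 addrAC dotvDl dotvZl; lra.
have := main (idx b - idx a)%N; rewrite subnKC ?idx_mono// ?leqnn => /(_ isT).
rewrite -/(X b) -/(X a) -/(Y b) -/(Y a) natrB ?idx_mono// mulrBr.
set e := h * (idx b)%:R - h * (idx a)%:R => h1; apply: (le_trans h1).
(* The grid time [e] elapsed between the two indices differs from [b - a] by less than [h]. *)
have : q * (e - (b - a)) <= `|q| * d.
  apply: (le_trans (ler_norm _)); rewrite normrM ler_wpM2l//.
  by rewrite ler_norml /e; apply/andP; split; lra.
by lra.
Qed.

Lemma approx_trajectory_exists (t0 u0 d : R) (x0 : 'rV[R]_N) : 0 <= t0 < T ->
  `|x0| <= r + 1 -> U t0 x0 = u0%:E -> 0 < d <= 1 ->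
  exists X Y, approx_trajectory T L U r C m t0 x0 u0 d X Y.
Proof.
move=> /andP[t00 t0T] x0r U0 /andP[d0 d1].
have t0T' : 0 <= t0 <= T by rewrite t00 ltW.
have mu0 : - m < u0 by have := hmU t0T' x0r; rewrite U0 lte_fin.
pose c1 := 1 + N%:R * C ^+ 2.
have c10 : 0 <= c1 by rewrite addr_ge0// mulr_ge0// sqr_ge0.
(* [u] grows by at most [m * (T - t0)]; the final 1 covers the accumulated errors. *)
pose B := u0 + m * (T - t0) + 1.
have mT : 0 <= m * (T - t0) by rewrite mulr_ge0//; lra.
have cT : 0 <= (T - t0) * c1 by rewrite mulr_ge0//; lra.
(* With [eps = d ^+ 2 / Q], the first summand gives [epsB], the second bounds the total error by
   [d ^+ 2 / 2], and the third gives [2 * eps <= d ^+ 2]. *)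
pose Q := 16 * (B + m) + (T - t0) * c1 + 2.
have Bm0 : 0 < B + m by rewrite /B; lra.
have Q2 : 2 <= Q by rewrite /Q; lra.
have Q0 : 0 < Q by lra.
pose eps := d ^+ 2 / Q.
have dd0 : 0 < d ^+ 2 by rewrite exprn_gt0.
have dd : d ^+ 2 <= d by rewrite expr2 ler_piMr// ltW.
have eps0 : 0 < eps by rewrite divr_gt0.
have epsQ : eps * Q = d ^+ 2 by rewrite divfK// gt_eqF.
have epsd : 2 * eps <= d ^+ 2 by rewrite -epsQ mulrC ler_wpM2l// ltW.
(* An error of order [h ^+ 2 / eps] per step is then of order [eps] per unit of time. *)
pose h := eps ^+ 2.
have h0 : 0 < h by rewrite exprn_gt0.
have heps : h <= eps by rewrite /h expr2 ler_piMr// ?(ltW eps0)//; lra.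
have hd : 2 * h <= d by lra.
pose k := h ^+ 2 * c1 / (2 * eps).
have kE : k = h * (eps * c1 / 2) by rewrite /k /h; field; rewrite gt_eqF.
have k0 : 0 <= k by rewrite kE mulr_ge0 ?(ltW h0)// divr_ge0// mulr_ge0// ltW.
have [idx [[idx0 idxT] idx_mono idx_lip idx_le]] := step_index h0 t0T.
pose M := idx T.
have hM : h * M%:R <= T - t0 by have /andP[] := idx_le _ (ltW t0T) (lexx T).
have ik i : (i <= M)%N -> i%:R * k <= d ^+ 2 / 2.
  move=> iM; apply: (@le_trans _ _ ((T - t0) * (eps * c1 / 2))).
    have ec0 : 0 <= eps * c1 / 2 by rewrite divr_ge0// mulr_ge0// ltW.
    rewrite kE mulrA (ler_wpM2r ec0)//.
    by apply: le_trans hM; rewrite mulrC ler_wpM2l ?(ltW h0)// ler_nat.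
  have : eps * ((T - t0) * c1) <= eps * Q by rewrite ler_wpM2l ?(ltW eps0)// /Q; lra.
  by rewrite epsQ; lra.
have BM : u0 + M%:R * (h * m + k) <= B.
  have : M%:R * (h * m) <= m * (T - t0).
    by rewrite mulrCA mulrA [_ * m]mulrC ler_wpM2l// mulrC.
  by have := ik M (leqnn M); rewrite /B mulrDr; lra.
have epsB : 2 * eps * (B + m) <= d ^+ 2 / 8.
  have : eps * (16 * (B + m)) <= eps * Q by rewrite ler_wpM2l ?(ltW eps0)// /Q; lra.
  by rewrite epsQ; lra.
have epsB1 : 2 * eps * (B + m) < 1 by lra.
have [w [j [[w0 jM] mv cst inv stuck]]] := euler_chain eps0 h0 t0T' x0r U0 (erefl k) BM epsB1.
exists (fun t => (w (idx t)).1.2), (fun t => (w (idx t)).2).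
have d01 : 0 < d <= 1 by rewrite d0.
exact: (euler_interpolation eps0 h0 d01 k0 hd t0T idx0 idxT idx_mono idx_lip idx_le ik BM epsB
  w0 jM mv cst inv stuck).
Qed.

End euler_step.

(** * Passage to the limit along an ultrafilter *)

(** If no point is a limit, each has a neighbourhood that [f] avoids on a set of the ultrafilter. By
    compactness some [f i] would then differ from every point of [K]. *)
Lemma ultra_compact_cvg (I : Type) (G : set_system I) (V : topologicalType) (K : set V)
    (f : I -> V) : UltraFilter G -> compact K -> (forall i, K (f i)) -> exists p : V, f @ G --> p.
Proof.
move=> GU /compact_near_coveringP cK Kf; apply: contrapT => nolim.
have GF : ProperFilter G by exact: ultra_proper.
have : \forall i \near G, K `<=` (fun p => f i <> p).
  apply: cK => p Kp.
  have [A [Ap nA]] : exists A, nbhs p A /\ G (~` (f @^-1` A)).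
    apply: contrapT => h; apply: nolim; exists p => A Ap.
    by have [//|nA] := in_ultra_setVsetC (f @^-1` A) GU; case: h; exists A.
  exists (A, ~` (f @^-1` A)) => //= -[q i] /= [Aq nAi] fiq; apply: nAi.
  by rewrite /preimage /= fiq.
by move=> /filter_ex[i /(_ (f i) (Kf i))].
Qed.

Section limit.
Context {R : realType} {N : nat} (T : R) (L : R -> 'rV[R]_N -> 'rV[R]_N -> \bar R)
  (U : R -> 'rV[R]_N -> \bar R).
Hypotheses (hL1 : L1 T L) (hL4 : L4 T L) (Ulsc : U_lsc T U).
Variables (r C m t0 u0 : R) (x0 : 'rV[R]_N).
Hypotheses (C0 : 0 <= C) (m0 : 0 <= m) (t00 : 0 <= t0).

(** At each time the approximations stay in a fixed compact set, so pointwise limits along one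
    ultrafilter exist at all times at once. The estimates are closed inequalities, in which the
    slack tends to 0. *)
Lemma limit_trajectory (X : nat -> R -> 'rV[R]_N) (Y : nat -> R -> R) :
  (forall n, approx_trajectory T L U r C m t0 x0 u0 n.+1%:R^-1 (X n) (Y n)) ->
  exists (x : R -> 'rV[R]_N) (u : R -> R),
  [/\ [/\ x t0 = x0, u t0 = u0, forall t, t <= t0 -> x t = x t0 /\ u t = u t0 &
        forall t, T <= t -> x t = x T /\ u t = u T],
      forall s t, s <= t -> `|x t - x s| <= C * (t - s),
      forall s t, s <= t -> u t - u s <= m * (t - s),
      forall s t, t0 <= s <= T -> s <= t -> `|x t| < r -> (U s (x s) <= (u s)%:E)%E &
      forall b t p k, t0 < b < T -> b <= t -> `|x t| < r ->
        (forall v, ((dotv v p - k)%:E < L b (x b) v)%E) ->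
        exists2 rho : R, 0 < rho & forall a, t0 <= a -> a <= b -> b - a < rho ->
          dotv (x b - x a) p + (u b - u a) <= k * (b - a)].
Proof.
move=> apx.
pose d (n : nat) : R := n.+1%:R^-1.
have d0 n : 0 < d n by rewrite invr_gt0.
have d1 n : d n <= 1 by rewrite invf_le1// ler1n.
have [G [GU Goo]] := @ultraFilterLemma nat (nbhs \oo) _.
have GF : ProperFilter G by exact: ultra_proper.
have dcvg : d @ G --> (0 : R).
  have dc : d @ \oo --> (0 : R) by exact: cvg_harmonic.
  by move=> A /dc; exact: Goo.
have /choice[x xP] : forall t, exists y : 'rV[R]_N, X n t @[n --> G] --> y.
  move=> t; pose B := `|x0| + C * (`|t - t0| + 1).
  apply: (ultra_compact_cvg (K := [set y | `|y| <= B]) GU); first exact: compact_normv_ball.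
  move=> n /=; have [[X0 _ Xl _ _] lip _ _ _] := apx n.
  have [tt0|/ltW tt0] := leP t t0.
    by have [-> _] := Xl t tt0; rewrite X0 lerDl mulr_ge0// addr_ge0.
  have [h1 _] := lip _ _ tt0; rewrite X0 in h1.
  have h2 : C * (t - t0 + n.+1%:R^-1) <= C * (`|t - t0| + 1).
    by rewrite ler_wpM2l// lerD ?ler_norm//; exact: d1.
  have {h2}h1 := le_trans h1 h2; have := ler_normD (X n t - x0) x0.
  by rewrite subrK => /le_trans; apply; rewrite /B addrC lerD2l.
have /choice[u uP] : forall t, exists y : R, Y n t @[n --> G] --> y.
  move=> t; pose B := `|u0| + m * (`|t - t0| + 1).
  apply: (ultra_compact_cvg (K := `[- (m + 1), B]%classic) GU); first exact: segment_compact.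
  move=> n /=; have [[_ Y0 Yl _ _] lip Ylb _ _] := apx n.
  rewrite in_itv/= Ylb /=; have [tt0|/ltW tt0] := leP t t0.
    have [_ ->] := Yl t tt0; rewrite Y0 /B; apply: (le_trans (ler_norm _)).
    by rewrite lerDl mulr_ge0// addr_ge0.
  have [_ h1] := lip _ _ tt0; rewrite Y0 in h1.
  have h2 : m * (t - t0 + n.+1%:R^-1) <= m * (`|t - t0| + 1).
    by rewrite ler_wpM2l// lerD ?ler_norm//; exact: d1.
  have {h2}h1 := le_trans h1 h2; rewrite -[Y n t](subrK u0) /B addrC.
  by rewrite lerD// ler_norm.
have uniqV (V : normedModType R) (f g : nat -> V) (a b : V) : f = g ->
    f @ G --> a -> g @ G --> b -> a = b.
  by move=> -> fa fb; exact: (cvg_unique (@norm_hausdorff _ _) fa fb).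
have cstx (y : 'rV[R]_N) t : (forall n, X n t = y) -> x t = y.
  move=> Xy; have yc : (fun=> y) @ G --> y by exact: cvg_cst.
  by apply: (uniqV _ _ _ _ _ _ (xP t) yc); apply/funext.
have csty (y : R) t : (forall n, Y n t = y) -> u t = y.
  move=> Yy; have yc : (fun=> y) @ G --> y by exact: cvg_cst.
  by apply: (uniqV _ _ _ _ _ _ (uP t) yc); apply/funext.
have Xcongr s t : (forall n, X n s = X n t) -> x s = x t.
  by move=> Xst; apply: (uniqV _ _ _ _ _ _ (xP s) (xP t)); apply/funext.
have Ycongr s t : (forall n, Y n s = Y n t) -> u s = u t.
  by move=> Yst; apply: (uniqV _ _ _ _ _ _ (uP s) (uP t)); apply/funext.
have xlim_lt t e : 0 < e -> \forall n \near G, `|X n t - x t| < e.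
  by move=> e0; have := xP t => /cvgr_dist_lt/(_ e e0); apply: filterS => n; rewrite distrC.
have dlim_lt e : 0 < e -> \forall n \near G, d n < e.
  by move=> e0; exact: (cvgr_lt _ dcvg).
(* A trajectory outside the ball at time [s] is frozen there and could not come near [x t] later.
   One bound at the later time [t] thus controls all earlier times. *)
have inball s t : s <= t -> `|x t| < r -> \forall n \near G, `|X n s| <= r.
  move=> st xr; have : \forall n \near G, `|X n t - x t| < r - `|x t| by apply: xlim_lt; lra.
  apply: filterS => n h; rewrite leNgt; apply/negP => rX.
  have [[_ _ _ _ ex] _ _ _ _] := apx n.
  have e := ex _ _ st rX; rewrite -e in rX.
  by have := ler_normD (X n t - x t) (x t); rewrite subrK; lra.
exists x, u; split.
- split.
  + by apply: cstx => n; have [[-> _]] := apx n.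
  + by apply: csty => n; have [[_ -> _]] := apx n.
  + move=> t tt0; split; [apply: Xcongr => n|apply: Ycongr => n];
      by have [[_ _ /(_ _ tt0)[]]] := apx n.
  + move=> t tt0; split; [apply: Xcongr => n|apply: Ycongr => n];
      by have [[_ _ _ /(_ _ tt0)[]]] := apx n.
- move=> s t st.
  have c1 : `|X n t - X n s| @[n --> G] --> `|x t - x s|.
    by apply: cvg_norm; exact: cvgB.
  have c2 : C * (t - s + d n) @[n --> G] --> C * (t - s).
    rewrite -[X in _ --> C * X]addr0; apply: cvgM; first exact: cvg_cst.
    by apply: cvgD => //; exact: cvg_cst.
  apply: (ler_cvg_to c1 c2); apply: nearW => n.
  by have [_ /(_ _ _ st)[]] := apx n.
- move=> s t st.
  have c1 : Y n t - Y n s @[n --> G] --> u t - u s by exact: cvgB.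
  have c2 : m * (t - s + d n) @[n --> G] --> m * (t - s).
    rewrite -[X in _ --> m * X]addr0; apply: cvgM; first exact: cvg_cst.
    by apply: cvgD => //; exact: cvg_cst.
  apply: (ler_cvg_to c1 c2); apply: nearW => n.
  by have [_ /(_ _ _ st)[]] := apx n.
(* Otherwise [U > a > u s] near [(s, x s)], against the touching points that converge to
   [(s, x s)]. *)
- move=> s t /andP[t0s sT] st xr; rewrite leNgt; apply/negP => /lte_real_dense[a ua aU].
  have sT' : 0 <= s <= T by rewrite sT (le_trans t00).
  have [e e0 He] := U_lsc_within Ulsc sT' aU.
  have e20 : 0 < e / 2 by rewrite divr_gt0.
  have c1 : Y n s + d n @[n --> G] --> u s + 0 by exact: cvgD.
  rewrite addr0 in c1.
  have [n [[h1 h2] [h3 h4]]] := filter_ex (filterI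
    (filterI (inball _ _ st xr) (xlim_lt s _ e20)) (filterI (dlim_lt _ e20) (cvgr_lt _ c1 _ ua))).
  have [_ _ _ /(_ s) + _] := apx n; rewrite t0s sT => /(_ isT)[|[s' [y [s'T ss' ys Usy]]]].
    by rewrite ltNge h1.
  have : (a%:E < U s' y)%E.
    apply: He => //; first by apply: (le_lt_trans ss'); rewrite -/(d n); lra.
    rewrite -(subrKA (X n s)); apply: (le_lt_trans (ler_normD _ _)).
    by move: ys; rewrite -/(d n); lra.
  by rewrite ltNge => /negP; apply; apply: (le_trans Usy); rewrite lee_fin ltW.
move=> b t p k /andP[t0b bT] bt xr Lk.
have bT' : 0 <= b <= T by rewrite (ltW bT) andbT ltW// (le_lt_trans t00).
have [k' [e [k'k e0 stab]]] := affine_minorant_stable hL1 hL4 bT' Lk.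
have C0' := C0; have C1 : 0 < 4 * (C + 1) by lra.
(* The distance from [y] to [x b] splits into [C * (b - a)], [C * d n], [d n] and [|X n b - x b|],
   each less than [e / 4]. *)
exists (e / (4 * (C + 1))) => [|a t0a ab abe]; first by rewrite divr_gt0.
have e40 : 0 < e / (4 * (C + 1)) by rewrite divr_gt0.
have c1 : dotv (X n b - X n a) p + (Y n b - Y n a) @[n --> G] -->
    dotv (x b - x a) p + (u b - u a).
  apply: cvgD; last exact: cvgB.
  by apply: cvg_dotv; [exact: cvgB|exact: cvg_cst].
have c2 : k * (b - a) + `|k| * d n @[n --> G] --> k * (b - a).
  rewrite -[X in _ --> X]addr0 -[X in _ --> _ + X](mulr0 `|k|).
  apply: cvgD; first exact: cvg_cst.
  by apply: cvgM => //; exact: cvg_cst.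
apply: (ler_cvg_to c1 c2).
have bT0 : 0 < T - b by lra.
have e20 : 0 < e / 4 by rewrite divr_gt0.
near=> n.
have h1 : `|X n b| <= r by near: n; exact: inball bt xr.
have h2 : `|X n b - x b| < e / 4 by near: n; exact: xlim_lt.
have h3 : d n < e / (4 * (C + 1)) by near: n; exact: dlim_lt.
have h4 : d n < T - b by near: n; exact: dlim_lt.
have h5 : d n < e / 4 by near: n; exact: dlim_lt.
have [_ _ _ _ /(_ a b p k t0a ab) []] := apx n; first by rewrite -/(d n); lra.
  by rewrite ltNge h1.
apply=> s y v l sT sb yX Ll.
move: abe h3; rewrite !ltr_pdivlMr// => abe h3; rewrite -/(d n) in sb yX.
have Cd : 0 <= C * (d n) by rewrite mulr_ge0// ltW.
have Cab : 0 <= C * (b - a) by rewrite mulr_ge0// subr_ge0.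
have : ((dotv v p - k')%:E < L s y v)%E.
  apply: stab => //; first by apply: (le_lt_trans sb); have := d0 n; lra.
  rewrite -(subrKA (X n b)); apply: (le_lt_trans (ler_normD _ _)).
  by have := d0 n; lra.
by rewrite Ll lte_fin; lra.
Unshelve. all: by end_near. Qed.
End limit.

(** * A priori bound and differential inclusion for the limit trajectory *)

Section trajectory_analysis.
Context {R : realType}.
Notation mu := (@lebesgue_measure R).

Lemma ae_imply2 (P Q S : R -> Prop) : {ae mu, forall t, P t} -> {ae mu, forall t, Q t} ->
  (forall t, P t -> Q t -> S t) -> {ae mu, forall t, S t}.
Proof. by move=> hP hQ PQS; exact: (@filterS2 _ _ (ae_filter_ringOfSetsType mu) P Q S). Qed.

Lemma lipschitz_row_continuous (N : nat) (x : R -> 'rV[R]_N) (C : R) : 0 <= C ->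
  (forall s t, s <= t -> `|x t - x s| <= C * (t - s)) -> continuous (fun t => `|x t|).
Proof.
move=> C0 lip t; apply: cvg_norm; apply/cvgrPdist_lt => e e0.
have C1 : 0 < C + 1 by lra.
apply/nbhs_ballP; exists (e / (C + 1)); first by rewrite /= divr_gt0.
move=> s /= st.
apply: (@le_lt_trans _ _ (C * `|t - s|)).
  have [ts|/ltW ts] := leP t s.
    by rewrite distrC (distrC t) (@ger0_norm _ (s - t)) ?subr_ge0// lip.
  by rewrite (@ger0_norm _ (t - s)) ?subr_ge0// lip.
move: st; rewrite ltr_pdivlMr//; have := normr_ge0 (t - s); lra.
Qed.

(* Gronwall without exponentials: each time interval of length less than [dl] at most doubles
   [1 + `|x|], because the integral of [c] over it is below [1/2]. *)
Lemma gronwall (N : nat) (x : R -> 'rV[R]_N) (xi : 'I_N -> R -> R) (c : R -> R)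
    (t0 t1 C dl : R) : 0 <= C ->
  (forall s t, s <= t -> `|x t - x s| <= C * (t - s)) ->
  (forall i, mu.-integrable setT (EFin \o xi i)) ->
  (forall i s t, s <= t -> x t 0 i - x s 0 i = \int[mu]_(r in `]s, t]) xi i r) ->
  mu.-integrable setT (EFin \o c) -> (forall s, 0 <= c s) ->
  {ae mu, forall s, t0 < s < t1 -> forall i, `|xi i s| <= c s * (1 + `|x s|)} ->
  0 < dl ->
  (forall A : set R, measurable A -> (mu A < dl%:E)%E ->
    (\int[mu]_(r in A) `|c r|%:E < (2^-1)%:E)%E) ->
  forall (n : nat) s, t0 <= s <= t1 -> s - t0 <= n%:R * (dl / 2) ->
    1 + `|x s| <= 2 ^+ n * (1 + `|x t0|).
Proof.
move=> C0 lip xii xiE ci c0 aexi dl0 small.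
have xc := lipschitz_row_continuous C0 lip.
have mc : measurable_fun [set: R] c by apply/measurable_EFinP; exact: measurable_int ci.
elim=> [|n IH] s /andP[t0s st1].
  rewrite mul0r subr_le0 => st0; have -> : s = t0 by apply/eqP; rewrite eq_le st0.
  by rewrite expr0 mul1r.
rewrite -natr1 mulrDl mul1r => sn.
pose a := Num.max t0 (s - dl / 2).
have t0a : t0 <= a by rewrite le_max lexx.
have as_ : a <= s by rewrite ge_max t0s gerBl divr_ge0// ltW.
have an : a - t0 <= n%:R * (dl / 2).
  rewrite lerBlDr ge_max; apply/andP; split; last first.
    by rewrite lerBlDr addrAC -lerBlDr.
  by rewrite lerDr mulr_ge0// divr_ge0// ltW.
have sa : s - dl / 2 <= a by rewrite le_max lexx orbT.
(* At a maximum [z] of [|x|] on [[a, s]] the growth bound is at most [B * c]; then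
   [|x z - x a| <= B / 2] gives [B <= 2 * (1 + |x a|)]. *)
have [z] := EVT_max as_ (continuous_subspaceT xc).
rewrite in_itv/= => /andP[az zs] zmax.
have xs : `|x s| <= `|x z| by apply: zmax; rewrite in_itv/= as_ lexx.
have xa : 1 + `|x a| <= 2 ^+ n * (1 + `|x t0|).
  by apply: IH => //; rewrite t0a (le_trans as_).
pose B := 1 + `|x z|.
have B0 : 0 <= B by rewrite addr_ge0.
suff h : `|x z - x a| <= B / 2.
  have := ler_normD (x z - x a) (x a); rewrite subrK exprS -mulrA /B in h *; lra.
apply: row_norm_le => [|i]; first by rewrite divr_ge0.
rewrite !mxE -lee_fin.
apply: (le_trans (@normr_increment_le R (xi i) (fun t => x t 0 i) a z az (xii i) (xiE i a z az))).
have mxi : measurable_fun [set: R] (xi i) by apply/measurable_EFinP; exact: measurable_int (xii i).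
apply: (@le_trans _ _ (\int[mu]_(r in `]a, z]) (B * c r)%:E)%E).
  apply: ae_ge0_le_integral => //.
  - by apply/measurable_EFinP; apply: measurableT_comp => //; exact: measurable_funS mxi.
  - by move=> r _; rewrite lee_fin mulr_ge0.
  - by apply/measurable_EFinP; apply: measurable_funM => //; exact: measurable_funS mc.
  (* The growth bound is assumed on an open interval only, and [z] may be its right end. *)
  have nz : {ae mu, forall r : R, r <> z}.
    exists [set z]; split => //; first exact: lebesgue_measure_set1.
    by move=> r /= /contrapT.
  apply: (ae_imply2 nz aexi) => r rz h /=; rewrite in_itv/= => /andP[ar rz'].
  have rlt : r < z by rewrite lt_neqAle rz' andbT; apply/eqP.
  rewrite lee_fin; apply: le_trans (h _ i) _.
    by rewrite (le_lt_trans t0a ar) (lt_le_trans rlt)// (le_trans zs).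
  rewrite mulrC ler_wpM2r// lerD2l; apply: zmax; rewrite in_itv/=.
  by rewrite (ltW ar) (le_trans rz').
have -> : (\int[mu]_(r in `]a, z]) (B * c r)%:E = B%:E * \int[mu]_(r in `]a, z]) `|c r|%:E)%E.
  rewrite -ge0_integralZl//; last first.
    by apply/measurable_EFinP; apply: measurableT_comp => //; exact: measurable_funS mc.
  by apply: eq_integral => r _; rewrite EFinM ger0_norm.
rewrite EFinM lee_wpmul2l ?lee_fin//; apply/ltW/small => //.
rewrite lebesgue_measure_itv/= lte_fin; case: ifPn => _; last by rewrite lte_fin.
by rewrite -EFinB lte_fin; lra.
Qed.

Lemma is_derive_backward_quotient (f : R -> R) (t v : R) : is_derive t (1 : R) f v ->
  (f t - f (t - n.+1%:R^-1)) / n.+1%:R^-1 @[n --> \oo] --> v.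
Proof.
move=> [df dv]; have := df; rewrite /derivable => /cvg_ex[l fl].
have lv : l = v by rewrite -dv; apply/esym/cvg_lim.
move: fl; rewrite lv => /cvgr_dnbhsP/(_ (fun n => - n.+1%:R^-1)).
have hn : (forall n : nat, - n.+1%:R^-1 != 0 :> R) /\ (- n.+1%:R^-1 : R) @[n --> \oo] --> (0 : R).
  split=> [n|]; first by rewrite oppr_eq0 invr_eq0 pnatr_eq0.
  by rewrite -[X in _ --> X]oppr0; apply: cvgN; exact: cvg_harmonic.
move=> /(_ hn); apply: cvg_trans; apply: near_eq_cvg; apply: nearW => n.
rewrite [X in (f \o _) X](_ : _ = - n.+1%:R^-1); last exact: mulr1.
set h := n.+1%:R^-1; rewrite (_ : (f \o shift t) (- h) = f (t - h)); last by rewrite /= addrC.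
by rewrite [LHS](_ : _ = (- h)^-1 * (f (t - h) - f t))// invrN mulNr -mulrN opprB mulrC.
Qed.

(** If the conclusion failed, an affine minorant of [L] would have [k < <v, p> + (m - gr)]. But the
    backward quotients of [<x, p> + u] are at most [k], while those of [u] come arbitrarily close to
    [m - gr] or above for arbitrarily large [n]. *)
Lemma backward_quotient_inclusion (N : nat) (T : R) (L : R -> 'rV[R]_N -> 'rV[R]_N -> \bar R)
    (x : R -> 'rV[R]_N) (u : R -> R) (m t0 t gr : R) (v : 'rV[R]_N) :
  L1 T L -> L2 T L -> L4 T L -> 0 <= t0 -> t0 < t < T ->
  (forall p k, (forall w, ((dotv w p - k)%:E < L t (x t) w)%E) ->
    exists2 rho : R, 0 < rho & forall a, t0 <= a -> a <= t -> t - a < rho ->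
      dotv (x t - x a) p + (u t - u a) <= k * (t - a)) ->
  (forall i, is_derive t (1 : R) (fun s => x s 0 i) (v 0 i)) ->
  (limn_einf (fun n =>
     (((m * Num.max t t0 - u t) - (m * Num.max (t - n.+1%:R^-1) t0 - u (t - n.+1%:R^-1)))
       / n.+1%:R^-1)%:E) <= gr%:E)%E ->
  (L t (x t) v <= (- (m - gr))%:E)%E.
Proof.
move=> hL1 hL2 hL4 t00 /andP[t0t tT] incl dx gle.
have tT' : 0 <= t <= T by rewrite (ltW tT) andbT ltW// (le_lt_trans t00).
rewrite leNgt; apply/negP => /(L_affine_minorant hL1 hL2 hL4 tT')[p [k [Lk kv]]].
have [rho rho0 hrho] := incl p k Lk.
pose h (n : nat) : R := n.+1%:R^-1.
have h0 n : 0 < h n by rewrite invr_gt0.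
pose z n := \sum_(i < N) (x t 0 i - x (t - h n) 0 i) / h n * p 0 i.
have zc : z n @[n --> \oo] --> dotv v p.
  apply: cvg_big => [|i _]; first exact: add_continuous.
  apply: cvgM; last exact: cvg_cst.
  exact: is_derive_backward_quotient.
have zE n : z n = dotv (x t - x (t - h n)) p / h n.
  by rewrite /z /dotv mulr_suml; apply: eq_bigr => i _; rewrite !mxE mulrAC.
(* [gr] plus half of the gap: one half absorbs the convergence of [z n], the other the lower
   limit. *)
pose c := gr + (dotv v p + (m - gr) - k) / 2.
have hc : h @ \oo --> (0 : R) by exact: cvg_harmonic.
have t0t' : 0 < t - t0 by lra.
have [n0 _ Hn] : \forall n \near \oo, [/\ h n < rho, h n < t - t0 & c < m - k + z n].
  near=> n; split.
  - by near: n; exact: (cvgr_lt _ hc).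
  - by near: n; exact: (cvgr_lt _ hc).
  - have : dotv v p - (dotv v p + (m - gr) - k) / 2 < z n.
      by near: n; apply: (cvgr_gt _ zc); lra.
    by rewrite /c; lra.
have gc : (gr%:E < c%:E :> \bar R)%E by rewrite lte_fin /c; lra.
have [n nn0] := limn_einf_lt_frequently n0 (le_lt_trans gle gc).
have [h1 h2 h3] := Hn n nn0; rewrite -/(h n) lte_fin => qc.
have th : t - (t - h n) = h n by rewrite opprB addrCA subrr addr0.
have := hrho (t - h n); rewrite th.
have -> : t0 <= t - h n by lra.
have -> : t - h n <= t by have := h0 n; lra.
rewrite h1 => /(_ isT isT isT) hh.
move: qc; rewrite !max_l; [|lra|lra].
rewrite ltr_pdivrMr// => qc.
clearbody c; move: h3; rewrite zE -(ltr_pM2r (h0 n)) !mulrDl divfK ?gt_eqF//.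
rewrite mulNr; lra.
Unshelve. all: by end_near. Qed.

Lemma abs_cont_pair (N : nat) (x : R -> 'rV[R]_N) (u : R -> R) (C a b : R) : 0 <= C ->
  (forall s t, s <= t -> `|x t - x s| <= C * (t - s)) -> abs_cont a b u ->
  abs_cont a b (fun t => (x t, u t)).
Proof.
move=> C0 lip acu e e0; have e20 : 0 < e / 2 by rewrite divr_gt0.
have [d d0 hd] := acu _ e20; have C1 : 0 < C + 1 by lra.
have eC : 0 < e / 2 / (C + 1) by rewrite divr_gt0.
exists (Num.min d (e / 2 / (C + 1))) => [|n s t st disj]; first by rewrite lt_min d0.
rewrite lt_min => /andP[sd sC].
apply: (@le_lt_trans _ _ (C * (\sum_(i < n) (t i - s i)) + \sum_(i < n) `|u (t i) - u (s i)|)).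
  rewrite mulr_sumr -big_split/=; apply: ler_sum => i _.
  have [_ [sti _]] := st i (ltn_ord i).
  rewrite prod_normE/= ge_max; apply/andP; split.
    by apply: le_trans (lip _ _ (ltW sti)) _; rewrite lerDl.
  by rewrite lerDr mulr_ge0// subr_ge0 ltW.
have h1 := hd n s t st disj sd.
move: sC; rewrite ltr_pdivlMr// => h2.
have h3 : 0 <= \sum_(i < n) (t i - s i).
  by apply: sumr_ge0 => i _; have [_ [sti _]] := st i (ltn_ord i); rewrite subr_ge0 ltW.
by lra.
Qed.

(* A limit of the scheme only satisfies a one-sided Lipschitz bound, so [u] may have a negative
   singular part; [w] is [u] with that part removed. *)
Lemma backward_quotient_majorant (u : R -> R) (m t0 T : R) : t0 <= T ->
  (forall s t, s <= t -> u t - u s <= m * (t - s)) -> (forall t, t <= t0 -> u t = u t0) ->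
  exists (e : R -> R) (w : R -> R),
  [/\ mu.-integrable setT (EFin \o e), forall s t, s <= t -> w t - w s = \int[mu]_(r in `]s, t]) e r,
      w t0 = u t0, forall t, t0 <= t <= T -> u t <= w t &
      {ae mu, forall t, t0 < t < T -> (limn_einf (fun n =>
     (((m * Num.max t t0 - u t) - (m * Num.max (t - n.+1%:R^-1) t0 - u (t - n.+1%:R^-1)))
       / n.+1%:R^-1)%:E) <= (m - e t)%:E)%E}].
Proof.
move=> t0T um ul.
(* Nondecreasing by the one-sided bound, and constant before [t0] as Fatou's estimate requires. *)
pose G t := m * Num.max t t0 - u t.
have Gl t : t <= t0 -> G t = G t0 by move=> tt0; rewrite /G (ul t tt0) (max_r tt0) maxxx.
have ndG : {homo G : s t / s <= t}.
  move=> s t st; have [st0|/ltW t0s] := leP s t0; last first.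
    rewrite /G !max_l ?(le_trans t0s)//; have := um _ _ st; lra.
  rewrite (Gl s st0); have [tt0|/ltW t0t] := leP t t0; first by rewrite (Gl t tt0).
  by rewrite /G maxxx max_l//; have := um _ _ t0t; lra.
pose q n t : R := (G t - G (t - n.+1%:R^-1)) / n.+1%:R^-1.
have q0 n t : 0 <= q n t by rewrite divr_ge0// subr_ge0 ndG// gerBl.
pose g t := limn_einf (fun n => (q n t)%:E).
have g0 t : (0 <= g t)%E by apply: limn_einf_ge0 => n; rewrite lee_fin.
have mq n : measurable_fun [set: R] (q n).
  apply: measurable_funM => //; apply: measurable_funB; first exact: nondecreasing_measurable.
  apply: measurableT_comp; first exact: nondecreasing_measurable.
  exact: measurable_funD.
have mg : measurable_fun [set: R] g.
  rewrite /g /limn_einf; apply: measurableT_comp => //.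
  apply: measurable_fun_limn_esup => n; apply: measurableT_comp => //.
  exact/measurable_EFinP.
have gint b : t0 <= b -> (\int[mu]_(t in `[t0, b]) g t <= (G b - G t0)%:E)%E.
  by move=> t0b; exact: fatou_backward_quotient.
have gi : mu.-integrable `[t0, T] g.
  apply/integrableP; split; first exact: measurable_funS mg.
  under eq_integral do rewrite gee0_abs//.
  exact: le_lt_trans (gint T t0T) (ltry _).
have gfin := @integrable_ae _ (measurableTypeR R) R mu _ (measurable_itv `[t0, T]) _ gi.
(* Where [g] is infinite, on a null set of [[t0, T]], [fine] returns 0, so [f <= g] holds
   everywhere. *)
pose f t := fine (g t).
have f0 t : 0 <= f t by rewrite fine_ge0.
have mf : measurable_fun [set: R] f by exact: measurableT_comp.
have fg t : ((f t)%:E <= g t)%E.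
  by rewrite /f; have := g0 t; case: (g t) => //= _; rewrite leey.
have fi : mu.-integrable `[t0, T] (EFin \o f).
  apply: le_integrable gi => //; first by apply/measurable_EFinP; exact: measurable_funS mf.
  by move=> t _; rewrite (gee0_abs (g0 t)) /= ger0_norm//; exact: fg.
pose e : R -> R := (fun t => m - f t) \_ `]t0, T].
have mi (a b : R) : mu.-integrable `]a, b] (EFin \o cst m).
  apply: (@integrableS _ (measurableTypeR R) R mu `[a, b]) => //.
    by apply: subset_itvr; rewrite bnd_simp.
  apply: continuous_compact_integrable; first exact: segment_compact.
  by apply: continuous_subspaceT => z; exact: cvg_cst.
have fio : mu.-integrable `]t0, T] (EFin \o f).
  by apply: integrableS fi => //; apply: subset_itvr; rewrite bnd_simp.
have ei : mu.-integrable setT (EFin \o e).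
  rewrite /e -restrict_EFin.
  apply/(@integrable_mkcond _ (measurableTypeR R) R mu _ _ (measurable_itv `]t0, T])).
  rewrite (_ : EFin \o _ = (EFin \o cst m) \- (EFin \o f))%E//.
  exact: integrableB.
have eii y : mu.-integrable `]-oo, y] (EFin \o e) by exact: integrableS ei.
pose w t := u t0 + \int[mu]_(r in `]-oo, t]) e r.
have wE s t : s <= t -> w t - w s = \int[mu]_(r in `]s, t]) e r.
  move=> st; have := @Rintegral_itvB R _ _ _ s (eii t); rewrite !bnd_simp => /(_ isT st) <-.
  by rewrite /w opprD addrACA subrr add0r.
have w0 : w t0 = u t0.
  rewrite /w (_ : \int[mu]_(r in _) _ = 0) ?addr0//.
  rewrite (@eq_Rintegral _ _ _ mu _ (cst 0)) ?Rintegral_cst ?mul0r// => r.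
  rewrite inE/= in_itv/= => rt0; rewrite /e patchE memNset//=.
  by rewrite in_itv/= ltNge rt0.
exists e, w; split=> //.
- move=> t /andP[t0t tT].
  have := wE _ _ t0t; rewrite w0.
  rewrite (@eq_Rintegral _ _ _ mu _ (fun r => m - f r)) => [|r]; last first.
    rewrite inE/= in_itv/= => /andP[t0r rt]; rewrite /e patchE mem_set//=.
    by rewrite in_itv/= t0r (le_trans rt).
  have fit : mu.-integrable `]t0, t] (EFin \o f).
    by apply: integrableS fio => //; apply: subset_itvl; rewrite bnd_simp.
  rewrite (@RintegralB _ _ _ mu _ (cst m) f)//.
  rewrite Rintegral_cst//= lebesgue_measure_itv/= lte_fin.
  have -> : fine (if (t0 < t)%R then t%:E - t0%:E else 0)%E = t - t0.
    by case: ltP => //= tt0; apply/esym/eqP; rewrite subr_eq0 eq_le tt0.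
  (* On [[t0, t]] the claim [u <= w] amounts to Fatou's bound for the increment of [G]. *)
  suff : \int[mu]_(r in `]t0, t]) f r <= G t - G t0.
    by rewrite /G maxxx (max_l t0t); lra.
  rewrite -lee_fin /Rintegral fineK; last exact: integrable_fin_num fit.
  apply: le_trans (gint t t0t).
  apply: (@le_trans _ _ (\int[mu]_(r in `]t0, t]) g r)%E).
    apply: ge0_le_integral => //.
    - by move=> r _; rewrite lee_fin.
    - by apply/measurable_EFinP; exact: measurable_funS mf.
    - exact: measurable_funS mg.
  apply: ge0_subset_integral => //; first exact: measurable_funS mg.
  by apply: subset_itvr; rewrite bnd_simp.
apply: (@filterS _ _ (ae_filter_ringOfSetsType mu) _ _ _ gfin) => t gt /andP[t0t tT].
have tI : `[t0, T]%classic t by rewrite /= in_itv/= !ltW.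
rewrite -[leLHS]/(g t) -(fineK (gt tI)) lee_fin /e patchE mem_set; last first.
  by rewrite /= in_itv/= t0t ltW.
by rewrite opprB addrCA subrr addr0.
Qed.
End trajectory_analysis.

(** * Choice of the constants, confinement to the ball, and the resulting trajectory *)

Theorem theorem4p3 (R : realType) (N : nat) (T : R)
  (L : R -> 'rV[R]_N -> 'rV[R]_N -> \bar R) (U : R -> 'rV[R]_N -> \bar R) :
  L1 T L -> L2 T L -> L3 T L -> L4 T L -> L5 T L ->
  U_proper T U -> U_lsc T U ->
  (forall (t : R) (x : 'rV[R]_N), 0 <= t < T -> U t x \is a fin_num ->
     forall (nt : R) (nx : 'rV[R]_N) (nu : R),
       normal_cone (epiU T U) (t, x, fine (U t x)) (nt, nx, nu) ->
       exists (tk : nat -> R) (xk : nat -> 'rV[R]_N) (ak : nat -> R)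
              (vk : nat -> 'rV[R]_N),
         [/\ forall k, 0 <= tk k <= T,
             (tk @ \oo --> t) /\ (xk @ \oo --> x), (ak @ \oo --> 0),
             forall k, L (tk k) (xk k) (vk k) \is a fin_num
           & forall k, nt + dotv (vk k) nx - nu * fine (L (tk k) (xk k) (vk k)) <= ak k]) ->
  forall (t0 : R) (x0 : 'rV[R]_N), 0 <= t0 < T -> U t0 x0 \is a fin_num ->
    exists (x : R -> 'rV[R]_N) (u : R -> R),
      [/\ abs_cont t0 T (fun t => (x t, u t)),
          x t0 = x0 /\ u t0 = fine (U t0 x0),
          ({ae (@lebesgue_measure R), forall t, t \in `[t0, T] ->
              [/\ derivable x t 1, derivable u t 1 & Qset L t (x t) ('D_1 x t, 'D_1 u t)]})
        & forall t, t0 <= t <= T -> (U t (x t) <= (u t)%:E)%E].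
Proof.
move=> hL1 hL2 _ hL4 hL5 Uprop Ulsc nc t0 x0 /andP[t00 t0T] Ufin.
have T0 : 0 <= T by rewrite ltW// (le_lt_trans t00).
have [c [c0 ci [Nn [Nn0 hc]]]] := hL5.
(* The factor [N + 1] converts the growth bound of [L5] from the Euclidean to the sup norm. *)
pose ct : R -> R := (fun s => N.+1%:R * c s) \_ `[0, T].
have ctE s : 0 <= s <= T -> ct s = N.+1%:R * c s.
  by move=> sT; rewrite /ct patchE mem_set//= in_itv.
have ct0 s : 0 <= ct s.
  rewrite /ct patchE; case: ifPn => // /set_mem/=; rewrite in_itv/= => sT.
  by rewrite mulr_ge0// c0.
have cti : (@lebesgue_measure R).-integrable setT (EFin \o ct).
  rewrite /ct -restrict_EFin.
  apply/(@integrable_mkcond _ (measurableTypeR R) R lebesgue_measure _ _ (measurable_itv `[0, T])).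
  rewrite (_ : EFin \o _ = (fun s => N.+1%:R%:E * (EFin \o c) s)%E); last first.
    by apply/funext => s /=; rewrite EFinM.
  exact: integrableZl.
have hct t x v : 0 <= t <= T -> ~ Nn t -> ct t * (1 + `|x|) < `|v| -> L t x v = +oo%E.
  move=> tT nN; rewrite (ctE t tT) => h; apply: hc => //.
  apply: lt_le_trans (normv_le_enorm _); apply: le_lt_trans h.
  rewrite [_ * c t]mulrC -mulrA ler_wpM2l ?c0// -natr1.
  have := enorm_le_normv x; have := normr_ge0 x; have := ler0n R N; nra.
have half0 : 0 < 2^-1 :> R by rewrite invr_gt0.
have [dl dl0 small] := integral_small half0 cti.
have dl20 : 0 < dl / 2 by rewrite divr_gt0.
pose n0 := Num.bound ((T - t0) / (dl / 2)).
have hn0 : T - t0 <= n0%:R * (dl / 2).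
  rewrite -ler_pdivrMr//; apply/ltW/archi_boundP.
  by rewrite divr_ge0 ?(ltW dl20)// subr_ge0 ltW.
(* [n0] intervals of length [dl / 2] cover [[t0, T]], and on each [1 + |x|] at most doubles. *)
pose r := 2 ^+ n0 * (1 + `|x0|).
have r1 : 1 + `|x0| <= r by rewrite /r ler_peMl ?addr_ge0// exprn_ege1// ler1n.
have r0 : 0 <= r by apply: le_trans r1; rewrite addr_ge0.
have r10 : 0 <= r + 1 by rewrite addr_ge0.
have x0r : `|x0| <= r + 1 by lra.
have [C C0 hC] := L4_normv hL4 r10.
have [m1 m10 hm1] := L_lbound hL1 hL2 hL4 r10.
have [m2 m20 hm2] := U_lbound T0 Uprop Ulsc r10.
pose m := Num.max m1 m2.
have m0 : 0 <= m by rewrite le_max m10.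
have hmL t x v : 0 <= t <= T -> `|x| <= r + 1 -> ((- m)%:E < L t x v)%E.
  move=> tT xr; apply: le_lt_trans (hm1 t x v tT xr).
  by rewrite lee_fin lerN2 le_max lexx.
have hmU t x : 0 <= t <= T -> `|x| <= r + 1 -> ((- m)%:E < U t x)%E.
  move=> tT xr; apply: le_lt_trans (hm2 t x tT xr).
  by rewrite lee_fin lerN2 le_max lexx orbT.
have U0 : U t0 x0 = (fine (U t0 x0))%:E by rewrite fineK.
have t0T' : 0 <= t0 < T by rewrite t00.
have /choice[XY hXY] : forall n : nat, exists p : (R -> 'rV[R]_N) * (R -> R),
    approx_trajectory T L U r C m t0 x0 (fine (U t0 x0)) n.+1%:R^-1 p.1 p.2.
  move=> n; have d1 : 0 < (n.+1%:R^-1 : R) <= 1 by rewrite invr_gt0 ltr0n invf_le1 ?ler1n ?ltr0n.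
  have [X [Y h]] := approx_trajectory_exists T0 hL1 hL4 Ulsc nc r0 C0 m0 hC hmL hmU t0T' x0r U0 d1.
  by exists (X, Y).
have [x [u [[xt0 ut0 xl xr] lip um Ux incl]]] :=
  limit_trajectory hL1 hL4 Ulsc C0 m0 t00 hXY.
have C1 : 0 < C + 1 by lra.
have /choice[xi hxi] : forall i : 'I_N, exists d : R -> R,
    [/\ (@lebesgue_measure R).-integrable setT (EFin \o d),
      forall s t, s <= t -> x t 0 i - x s 0 i = \int[lebesgue_measure]_(q in `]s, t]) d q &
      {ae (@lebesgue_measure R), forall t, is_derive (t : R) (1 : R) (fun s => x s 0 i) (d t)}].
  move=> i; apply: (@lipschitz_density R (fun t => x t 0 i) (C + 1) t0 T) => //.
  - exact: ltW.
  - have lip' s t : s <= t -> `|x t 0 i - x s 0 i| <= (C + 1) * (t - s).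
      move=> st; have := row_norm_coord (x t - x s) i; rewrite !mxE => /le_trans; apply.
      by apply: le_trans (lip _ _ st) _; rewrite ler_wpM2r ?subr_ge0//; lra.
    move=> s t; have [st|/ltW ts] := leP s t.
      by rewrite (@ger0_norm _ (t - s)) ?subr_ge0// lip'.
    by rewrite distrC (distrC t) (@ger0_norm _ (s - t)) ?subr_ge0// lip'.
  - by move=> t /xl[->].
  - by move=> t /xr[->].
pose v t : 'rV[R]_N := \row_i xi i t.
have ul t : t <= t0 -> u t = u t0 by move=> /xl[].
have [e [w [ei wE w0 uw aeg]]] := backward_quotient_majorant (ltW t0T) um ul.
have aex : {ae (@lebesgue_measure R), forall t, forall i,
    is_derive (t : R) (1 : R) (fun s => x s 0 i) (xi i t)}.
  apply: (@filter_forall _ _ _ _ (ae_filter_ringOfSetsType lebesgue_measure)) => i.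
  by have [] := hxi i.
have key b : b <= T -> `|x b| < r ->
    {ae (@lebesgue_measure R), forall t, t0 < t < b -> (L t (x t) (v t) <= (- e t)%:E)%E}.
  move=> bT xb; apply: (ae_imply2 aeg aex) => t ht dt /andP[t0t tb].
  have tT : t0 < t < T by rewrite t0t (lt_le_trans tb).
  have -> : - e t = - (m - (m - e t)) by ring.
  apply: (backward_quotient_inclusion (u := u) (t0 := t0) (m := m) hL1 hL2 hL4) => //.
  - by move=> p k; exact: (incl t b p k tT (ltW tb) xb).
  - by move=> i; rewrite mxE.
  - exact: ht.
(* Bootstrap: [|x b| < r] gives the inclusion on all of []t0, b[], and Gronwall improves the bound
   to [|x b| <= r - 1]. *)
have bound b : t0 <= b <= T -> `|x b| < r -> 1 + `|x b| <= r.
  move=> /andP[t0b bT] xb; rewrite /r -xt0.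
  apply: (@gronwall R N x xi ct t0 b C dl C0 lip _ _ cti ct0 _ dl0 small).
  - by move=> i; have [] := hxi i.
  - by move=> i s t; have [_ + _] := hxi i; exact.
  - have aeN : {ae (@lebesgue_measure R), forall t, ~ Nn t}.
      by apply: (negligibleS _ Nn0) => t /= /contrapT.
    apply: (ae_imply2 (key b bT xb) aeN) => t Lt nN tb i.
    have tT : 0 <= t <= T.
      by move: tb => /andP[t0t tb]; rewrite (ltW (le_lt_trans t00 t0t)) (ltW (lt_le_trans tb bT)).
    rewrite leNgt; apply/negP => h.
    have := Lt tb; rewrite (hct t (x t) (v t) tT nN) ?leye_eq//.
    by apply: lt_le_trans h _; have := row_norm_coord (v t) i; rewrite mxE.
  - by rewrite lexx andbT.
  - by apply: le_trans hn0; rewrite lerB.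
have xr' t : t0 <= t <= T -> `|x t| < r.
  move=> /andP[t0t tT]; rewrite ltNge; apply/negP => rx.
  have xc := lipschitz_row_continuous C0 lip.
  (* A continuous path from [|x0| <= r - 1] up to [r] would pass through [r - 1/2], a value excluded
     by [bound]. *)
  have [|z] := @IVT R (fun s => `|x s|) t0 t (r - 2^-1) t0t (continuous_subspaceT xc).
    by rewrite xt0 min_l ?max_r; lra.
  rewrite in_itv/= => /andP[t0z zt] zE.
  have := bound z; rewrite t0z (le_trans zt tT) zE => /(_ isT); lra.
have TT : t0 <= T <= T by rewrite (ltW t0T) lexx.
exists x, w; split.
- by apply: (abs_cont_pair C0 lip); exact: (abs_cont_integral _ _ ei wE).
- by rewrite xt0 w0 ut0.
(* The endpoints [t0] and [T] are discarded, since [key] concerns the open interval. *)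
- have ae0 (z : R) : {ae (@lebesgue_measure R), forall t : R, t <> z}.
    exists [set z]; split => //; first exact: lebesgue_measure_set1.
    by move=> t /= /contrapT.
  have aew := integral_ae_is_derive ei wE.
  have h1 := ae_imply2 (key T (lexx T) (xr' T TT)) aex (fun t P Q => conj P Q).
  have h2 := ae_imply2 (ae0 t0) (ae0 T) (fun t P Q => conj P Q).
  have h3 := ae_imply2 h1 aew (fun t P Q => conj P Q).
  apply: (ae_imply2 h2 h3) => t [tt0 tT] [[Lt dxt] [dwt dwE]].
  rewrite in_itv/= => /andP[t0t tT'].
  have dx : derivable x t 1.
    by apply/derivable_mxP => i j; rewrite (ord1 i); have [] := dxt j.
  split=> //; rewrite /Qset /= dwE derive_mx//.
  have -> : (\matrix_(i, j) 'D_1 (fun s => x s i j) t) = v t.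
    by apply/matrixP => i j; rewrite !mxE (ord1 i); have [] := dxt j.
  by apply: Lt; rewrite !lt_neqAle t0t tT' !andbT; apply/andP; split; apply/eqP => //; exact/nesym.
- move=> t tT; apply: (le_trans (Ux t t tT (lexx t) (xr' t tT))).
  by rewrite lee_fin uw.
Qed.
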